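(* For every $n\ge1$ there is a $\Sigma^0_2$ set $A$ which is low, $n$-join irreducible and $(n-1)$-join reducible.
   Context: $\le_e$ is enumeration reducibility ($A=\Gamma(B)$ for some c.e. set $\Gamma$ of axioms $\langle x,D\rangle$, $D$ finite); $<_e$, $\equiv_e$ as usual; $X\oplus Y=\{2x:x\in X\}\cup\{2x+1:x\in Y\}$. With $(\Gamma_e)_e$ a listing of c.e. sets, $K_X=\bigoplus_e\Gamma_e(X)$ and the enumeration jump is $X'=K_X\oplus(\omega\setminus K_X)$; $0'_e=\emptyset'$. $\Sigma^0_2$ sets are those $\le_e 0'_e$. $A$ is low if $A'\le_e 0'_e$. For $m\ge1$, $A$ is $m$-join irreducible if for all $A_0,\dots,A_m<_e A$ there are $i\ne j$ with $A_i\oplus A_j<_e A$, and $m$-join reducible if it is not $m$-join irreducible, i.e. there are $A_0,\dots,A_m<_e A$ with $A_i\oplus A_j\equiv_e A$ for all $i\ne j$. By convention every set is $0$-join reducible (so for $n=1$ the claim is that there is a low join irreducible $\Sigma^0_2$ set). *)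

(* Defs.v *)
From Stdlib Require Import Arith Cantor.

Definition natset := nat -> Prop.

Notation "⟨ x , y ⟩" := (Cantor.to_nat (x, y)) (at level 0, x at level 99, y at level 99).

(** Programs for the partial recursive functions of one argument; several
    arguments are passed as iterated Cantor pairs, so the projections are among
    the initial functions and the identity is [Pair Left Right]. *)
Inductive code : Type :=
| Zero | Succ | Left | Right
| Pair (f g : code)
| Comp (f g : code)
| Prec (f g : code)
| Mu (f : code).

(** Graph of h(a, 0) = f(a), h(a, n+1) = g(a, n, h(a, n)). *)
Fixpoint prec_graph (F G : nat -> nat -> Prop) (a n y : nat) : Prop :=
  match n with
  | 0 => F a y
  | S m => exists r, prec_graph F G a m r /\ G ⟨a, ⟨m, r⟩⟩ y
  end.

(** [eval c x y]: the program [c] halts on input [x] with output [y]. *)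
Fixpoint eval (c : code) (x y : nat) : Prop :=
  match c with
  | Zero => y = 0
  | Succ => y = S x
  | Left => y = fst (Cantor.of_nat x)
  | Right => y = snd (Cantor.of_nat x)
  | Pair f g => exists u v, eval f x u /\ eval g x v /\ y = ⟨u, v⟩
  | Comp f g => exists u, eval g x u /\ eval f u y
  | Prec f g =>
      prec_graph (eval f) (eval g)
        (fst (Cantor.of_nat x)) (snd (Cantor.of_nat x)) y
  | Mu f =>
      eval f ⟨x, y⟩ 0 /\
      forall k, k < y -> exists v, eval f ⟨x, k⟩ (S v)
  end.

Definition halts (c : code) (x : nat) : Prop := exists y, eval c x y.

Fixpoint encode (c : code) : nat :=
  match c with
  | Zero => ⟨0, 0⟩
  | Succ => ⟨0, 1⟩
  | Left => ⟨0, 2⟩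
  | Right => ⟨0, 3⟩
  | Pair f g => ⟨1, ⟨encode f, encode g⟩⟩
  | Comp f g => ⟨2, ⟨encode f, encode g⟩⟩
  | Prec f g => ⟨3, ⟨encode f, encode g⟩⟩
  | Mu f => ⟨4, encode f⟩
  end.

Lemma encode_inj (c d : code) : encode c = encode d -> c = d.
Proof.
  revert d; induction c; destruct d; cbn [encode]; intros E;
    apply Cantor.to_nat_inj in E; try discriminate E; try reflexivity;
    apply (f_equal snd) in E; cbn [snd] in E; f_equal; auto;
    apply Cantor.to_nat_inj in E; injection E; auto.
Qed.

(** The [e]-th c.e. set: the domain of the program with number [e], and the
    empty set if [e] is not the number of a program. *)
Definition ce_nth (e : nat) : natset :=
  fun x => exists c, encode c = e /\ halts c x.

Definition ce (W : natset) : Prop := exists e, forall x, W x <-> ce_nth e x.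

(** The finite set with canonical index [u] = sum of 2^y over its elements [y]. *)
Definition finset_of (u : nat) : natset := fun y => Nat.testbit u y = true.

(** [enum_op W B] is the set W(B), an axiom (x, D) being coded by [x] and the
    canonical index of [D]. *)
Definition enum_op (W B : natset) : natset :=
  fun x => exists u, W ⟨x, u⟩ /\ forall y, finset_of u y -> B y.

Definition le_e (A B : natset) : Prop :=
  exists W, ce W /\ forall x, A x <-> enum_op W B x.

Definition lt_e (A B : natset) : Prop := le_e A B /\ ~ le_e B A.

Definition join (X Y : natset) : natset :=
  fun z => (exists x, X x /\ z = 2 * x) \/ (exists y, Y y /\ z = 2 * y + 1).

(** The direct sum over [e] of the sets Γ_e(X), with [x] in the [e]-th summand
    coded as ⟨e, x⟩. *)
Definition K (X : natset) : natset :=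
  fun z => exists e x, z = ⟨e, x⟩ /\ enum_op (ce_nth e) X x.

Definition compl (X : natset) : natset := fun x => ~ X x.

Definition jump (X : natset) : natset := join (K X) (compl (K X)).

Definition zero_jump : natset := jump (fun _ => False).

Definition Sigma02 (A : natset) : Prop := le_e A zero_jump.

Definition low (A : natset) : Prop := le_e (jump A) zero_jump.

(** Meaningful for [m >= 1] only; the family is used at the indices [0..m]. *)
Definition join_irreducible (m : nat) (A : natset) : Prop :=
  forall B : nat -> natset,
    (forall i, i <= m -> lt_e (B i) A) ->
    exists i j, i <= m /\ j <= m /\ i <> j /\ lt_e (join (B i) (B j)) A.

(** Every set is 0-join reducible by convention. *)
Definition join_reducible (m : nat) (A : natset) : Prop :=
  m = 0 \/ ~ join_irreducible m A.

(* Main.v *)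
From Stdlib Require Import Arith Lia Classical Cantor.
Require Import Defs.

(** Let A be the direct sum of the left Dedekind cuts L_0, ..., L_(n-1) of mutually
    1-generic reals.  A c.e. family of neighbourhoods of the tuple is either met by
    it or missed by a whole neighbourhood of it; since a construction computable in
    the halting problem achieves this for all such families, A can be made low.

    The point is that each cut L_i is join-prime below A: if L_i is reducible to
    the join of B_0, B_1, both reducible to A, then to one of them.  Supports in A are
    closed under union and a cut is linearly ordered, so by genericity, near the
    generic point, an axiom putting r into L_i needs, for at least one of its two
    halves, a support in A that reaches r.  Either arbitrarily large r in L_i have an
    axiom whose B_0-half has a support below r, and then the B_1-halves of such
    axioms enumerate L_i; or a neighbourhood of the generic point excludes such axioms,
    and the B_0-halves enumerate L_i.

    A set strictly below A misses some L_i, so of n+1 such sets two miss the same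
    L_i, and so does their join.  Conversely, the n sets obtained from A by deleting
    one cut lie strictly below A, and any two of them join to A. *)

(** * Projections of Cantor pairs *)

Definition pi1 (x : nat) : nat := fst (Cantor.of_nat x).
Definition pi2 (x : nat) : nat := snd (Cantor.of_nat x).

Lemma pi1_pair (a b : nat) : pi1 ⟨a, b⟩ = a.
Proof. unfold pi1; now rewrite Cantor.cancel_of_to. Qed.

Lemma pi2_pair (a b : nat) : pi2 ⟨a, b⟩ = b.
Proof. unfold pi2; now rewrite Cantor.cancel_of_to. Qed.

Lemma pair_pi (x : nat) : ⟨pi1 x, pi2 x⟩ = x.
Proof.
  unfold pi1, pi2; rewrite <- surjective_pairing; apply Cantor.cancel_to_of.
Qed.

Lemma pi1_le (x : nat) : pi1 x <= x.
Proof.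
  rewrite <- (pair_pi x) at 2.
  pose proof (Cantor.to_nat_non_decreasing (pi1 x) (pi2 x)); lia.
Qed.

Lemma pi2_le (x : nat) : pi2 x <= x.
Proof.
  rewrite <- (pair_pi x) at 2.
  pose proof (Cantor.to_nat_non_decreasing (pi1 x) (pi2 x)); lia.
Qed.

(** Numbers of compound programs have a nonzero tag, so this gives the descent in the recursion on
    program numbers. *)
Lemma pi2_lt (x : nat) : pi1 x <> 0 -> pi2 x < x.
Proof.
  intros H; rewrite <- (pair_pi x) at 2.
  pose proof (Cantor.to_nat_non_decreasing (pi1 x) (pi2 x)); lia.
Qed.

Lemma pair_eq (x a b : nat) : x = ⟨a, b⟩ <-> pi1 x = a /\ pi2 x = b.
Proof.
  split.
  - intros ->; now rewrite pi1_pair, pi2_pair.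
  - intros [<- <-]; now rewrite pair_pi.
Qed.

(** * Finite sets coded by their canonical indices *)

Lemma finset_lt (u y : nat) : finset_of u y -> y < u.
Proof.
  unfold finset_of; intros H.
  destruct (Nat.lt_ge_cases y u) as [L | L]; [exact L | exfalso].
  destruct (Nat.eq_dec u 0) as [-> | N].
  - now rewrite Nat.bits_0 in H.
  - rewrite Nat.bits_above_log2 in H; [discriminate |].
    apply Nat.lt_le_trans with u; [apply Nat.log2_lt_lin; lia | exact L].
Qed.

Lemma finset_empty (y : nat) : ~ finset_of 0 y.
Proof. intros H; apply finset_lt in H; lia. Qed.

Lemma finset_union (u v y : nat) :
  finset_of (Nat.lor u v) y <-> finset_of u y \/ finset_of v y.
Proof.
  unfold finset_of; rewrite Nat.lor_spec.
  apply Bool.orb_true_iff.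
Qed.

Lemma finset_single (x y : nat) : finset_of (2 ^ x) y <-> y = x.
Proof.
  unfold finset_of; rewrite Nat.pow2_bits_eqb, Nat.eqb_eq; split; auto.
Qed.

Lemma finset_comprehension (P : nat -> Prop) (b : nat) :
  exists u, forall y, finset_of u y <-> y < b /\ P y.
Proof.
  induction b as [|b [u Hu]].
  - exists 0; intros y; split; [intros H; now apply finset_empty in H | lia].
  - destruct (classic (P b)) as [Pb | nPb].
    + exists (Nat.lor u (2 ^ b)); intros y.
      rewrite finset_union, finset_single, Hu.
      split; [intros [[? ?] | ->]; split; auto; lia |].
      intros [L Py]; destruct (Nat.eq_dec y b); [auto | left; split; auto; lia].
    + exists u; intros y; rewrite Hu; split; intros [L Py]; split; auto.
      destruct (Nat.eq_dec y b); [now subst | lia].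
Qed.

(** Bounded quantifiers over an arithmetical equation: in this form membership is visibly decidable
    by the closure lemmas below. *)
Lemma finset_testbit (u y : nat) :
  finset_of u y <->
  exists q, q < S u /\ exists r, r < S u /\ r < 2 ^ y /\ u = (2 * q + 1) * 2 ^ y + r.
Proof.
  unfold finset_of; rewrite Nat.testbit_true.
  assert (P : 0 < 2 ^ y) by (apply Nat.neq_0_lt_0, Nat.pow_nonzero; lia).
  split.
  - intros H.
    pose proof (Nat.div_mod_eq u (2 ^ y)) as E.
    pose proof (Nat.mod_upper_bound u (2 ^ y)) as B.
    pose proof (Nat.div_mod_eq (u / 2 ^ y) 2) as E2.
    set (k := u / 2 ^ y) in *; set (r := u mod 2 ^ y) in *.
    exists (k / 2); rewrite H in E2; split; [nia |].
    exists r; repeat split; try nia.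
  - intros (q & _ & r & _ & Lr & ->).
    replace (((2 * q + 1) * 2 ^ y + r) / 2 ^ y) with (2 * q + 1).
    + rewrite Nat.add_comm, Nat.mul_comm, Nat.Div0.mod_add; reflexivity.
    + rewrite Nat.div_add_l, (Nat.div_small r) by lia; lia.
Qed.

(** * Computable functions *)

Definition computable (f : nat -> nat) : Prop := exists c, forall x, eval c x (f x).

Lemma prec_graph_det (F G : nat -> nat -> Prop) (a n : nat) :
  (forall x y z, F x y -> F x z -> y = z) ->
  (forall x y z, G x y -> G x z -> y = z) ->
  forall y z, prec_graph F G a n y -> prec_graph F G a n z -> y = z.
Proof.
  intros HF HG; induction n as [|n IH]; cbn; intros y z.
  - exact (HF a y z).
  - intros (r & Hr & Hy) (r' & Hr' & Hz).
    rewrite (IH _ _ Hr Hr') in Hy; eauto.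
Qed.

Lemma eval_det (c : code) : forall x y z, eval c x y -> eval c x z -> y = z.
Proof.
  induction c; cbn [eval]; intros x y z; try (intros; congruence).
  - intros (u & v & Hu & Hv & ->) (u' & v' & Hu' & Hv' & ->).
    rewrite (IHc1 _ _ _ Hu Hu'), (IHc2 _ _ _ Hv Hv'); reflexivity.
  - intros (u & Hu & Hy) (u' & Hu' & Hz).
    rewrite (IHc2 _ _ _ Hu Hu') in Hy; eauto.
  - intros H1 H2; exact (prec_graph_det _ _ _ _ IHc1 IHc2 _ _ H1 H2).
  - intros [Hy Ly] [Hz Lz].
    destruct (Nat.lt_trichotomy y z) as [L | [E | L]]; [| exact E |].
    + destruct (Lz _ L) as [v Hv]; discriminate (IHc _ _ _ Hy Hv).
    + destruct (Ly _ L) as [v Hv]; discriminate (IHc _ _ _ Hz Hv).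
Qed.

Lemma computable_ext (f g : nat -> nat) :
  (forall x, f x = g x) -> computable f -> computable g.
Proof. intros E [c Hc]; exists c; intros x; rewrite <- E; auto. Qed.

Lemma computable_pair (f g : nat -> nat) :
  computable f -> computable g -> computable (fun x => ⟨f x, g x⟩).
Proof. intros [c Hc] [d Hd]; exists (Pair c d); cbn [eval]; eauto 8. Qed.

Lemma computable_comp (f g : nat -> nat) :
  computable f -> computable g -> computable (fun x => f (g x)).
Proof. intros [c Hc] [d Hd]; exists (Comp c d); cbn [eval]; eauto. Qed.

Lemma computable_pi1 (f : nat -> nat) : computable f -> computable (fun x => pi1 (f x)).
Proof. apply (computable_comp pi1); exists Left; reflexivity. Qed.

Lemma computable_pi2 (f : nat -> nat) : computable f -> computable (fun x => pi2 (f x)).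
Proof. apply (computable_comp pi2); exists Right; reflexivity. Qed.

Lemma computable_id : computable (fun x => x).
Proof.
  apply computable_ext with (fun x => ⟨pi1 x, pi2 x⟩); [exact pair_pi |].
  apply computable_pair; [exists Left | exists Right]; reflexivity.
Qed.

Lemma computable_succ (f : nat -> nat) : computable f -> computable (fun x => S (f x)).
Proof. apply (computable_comp S); exists Succ; reflexivity. Qed.

Lemma computable_const (k : nat) : computable (fun _ => k).
Proof.
  induction k as [|k IH]; [exists Zero; reflexivity |].
  now apply (computable_succ (fun _ => k)).
Qed.

(** Primitive recursion in the shape of [Prec], which hands its step program the packed triple of
    parameter, counter and previous value; hence the projections in the third hypothesis. The input
    [x] itself serves as the parameter. *)
Lemma computable_rec (f n : nat -> nat) (g : nat -> nat -> nat -> nat) :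
  computable f -> computable n ->
  computable (fun z => g (pi1 z) (pi1 (pi2 z)) (pi2 (pi2 z))) ->
  computable (fun x => nat_rect (fun _ => nat) (f x) (g x) (n x)).
Proof.
  intros [cf Hf] Hn [cg Hg].
  assert (H : computable
    (fun z => nat_rect (fun _ => nat) (f (pi1 z)) (g (pi1 z)) (pi2 z))).
  { exists (Prec cf cg); intros z; cbn [eval].
    fold (pi1 z); fold (pi2 z).
    induction (pi2 z) as [|m IH]; cbn [prec_graph nat_rect]; [apply Hf |].
    eexists; split; [exact IH |].
    match goal with |- eval _ ?w _ => specialize (Hg w) end.
    now repeat rewrite ?pi1_pair, ?pi2_pair in Hg. }
  pose proof (computable_comp _ _ H (computable_pair _ _ computable_id Hn)) as H'.
  revert H'; apply computable_ext; intros x; now rewrite pi1_pair, pi2_pair.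
Qed.

Lemma computable_add (f g : nat -> nat) :
  computable f -> computable g -> computable (fun x => f x + g x).
Proof.
  intros Hf Hg.
  apply computable_ext with
    (fun x => nat_rect (fun _ => nat) (f x) (fun _ r => S r) (g x)).
  - intros x; induction (g x) as [|m IH]; cbn; lia.
  - apply (computable_rec f g (fun _ _ r => S r)); auto.
    apply computable_succ, computable_pi2, computable_pi2, computable_id.
Qed.

Lemma computable_mul (f g : nat -> nat) :
  computable f -> computable g -> computable (fun x => f x * g x).
Proof.
  intros Hf Hg.
  apply computable_ext with
    (fun x => nat_rect (fun _ => nat) 0 (fun _ r => r + f x) (g x)).
  - intros x; induction (g x) as [|m IH]; cbn [nat_rect]; lia.
  - apply (computable_rec (fun _ => 0) g (fun x _ r => r + f x)); auto.
    + apply computable_const.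
    + apply computable_add; [apply computable_pi2, computable_pi2, computable_id |].
      apply (computable_comp f); auto using computable_pi1, computable_id.
Qed.

Lemma computable_sub (f g : nat -> nat) :
  computable f -> computable g -> computable (fun x => f x - g x).
Proof.
  assert (P : forall h, computable h -> computable (fun x => pred (h x))).
  { intros h Hh; apply computable_ext with
      (fun x => nat_rect (fun _ => nat) 0 (fun m _ => m) (h x)).
    - intros x; now destruct (h x).
    - apply (computable_rec (fun _ => 0) h (fun _ m _ => m)); auto.
      + apply computable_const.
      + apply computable_pi1, computable_pi2, computable_id. }
  intros Hf Hg.
  apply computable_ext with
    (fun x => nat_rect (fun _ => nat) (f x) (fun _ r => pred r) (g x)).
  - intros x; induction (g x) as [|m IH]; cbn [nat_rect]; lia.
  - apply (computable_rec f g (fun _ _ r => pred r)); auto.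
    apply P, computable_pi2, computable_pi2, computable_id.
Qed.

Lemma computable_pow (k : nat) (f : nat -> nat) :
  computable f -> computable (fun x => k ^ f x).
Proof.
  intros Hf.
  apply computable_ext with
    (fun x => nat_rect (fun _ => nat) 1 (fun _ r => k * r) (f x)).
  - intros x; induction (f x) as [|m IH]; cbn [nat_rect Nat.pow]; lia.
  - apply (computable_rec (fun _ => 1) f (fun _ _ r => k * r)); auto.
    + apply computable_const.
    + apply computable_mul; [apply computable_const |].
      apply computable_pi2, computable_pi2, computable_id.
Qed.

(** * Decidable predicates *)

(** Zero stands for truth, so conjunction becomes a sum, disjunction a product, and bounded
    universal quantification an iterated sum. *)
Definition decidable (P : nat -> Prop) : Prop :=
  exists f, computable f /\ forall x, P x <-> f x = 0.

Lemma decidable_ext (P Q : nat -> Prop) :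
  (forall x, P x <-> Q x) -> decidable P -> decidable Q.
Proof.
  intros E (f & Cf & Hf); exists f; split; [exact Cf |].
  intros x; rewrite <- E; auto.
Qed.

Lemma decidable_comp (P : nat -> Prop) (f : nat -> nat) :
  decidable P -> computable f -> decidable (fun x => P (f x)).
Proof.
  intros (g & Cg & Hg) Cf; exists (fun x => g (f x)); split; auto.
  now apply (computable_comp g).
Qed.

Lemma decidable_comp2 (P : nat -> nat -> Prop) (f g : nat -> nat) :
  decidable (fun z => P (pi1 z) (pi2 z)) -> computable f -> computable g ->
  decidable (fun x => P (f x) (g x)).
Proof.
  intros HP Cf Cg.
  apply decidable_ext with (fun x => P (pi1 ⟨f x, g x⟩) (pi2 ⟨f x, g x⟩)).
  - intros x; now rewrite pi1_pair, pi2_pair.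
  - apply (decidable_comp (fun z => P (pi1 z) (pi2 z))); auto.
    now apply computable_pair.
Qed.

Lemma decidable_not (P : nat -> Prop) : decidable P -> decidable (fun x => ~ P x).
Proof.
  intros (f & Cf & Hf); exists (fun x => 1 - f x); split.
  - apply computable_sub; auto using computable_const.
  - intros x; rewrite Hf; lia.
Qed.

Lemma decidable_and (P Q : nat -> Prop) :
  decidable P -> decidable Q -> decidable (fun x => P x /\ Q x).
Proof.
  intros (f & Cf & Hf) (g & Cg & Hg); exists (fun x => f x + g x); split.
  - now apply computable_add.
  - intros x; rewrite Hf, Hg; lia.
Qed.

Lemma decidable_or (P Q : nat -> Prop) :
  decidable P -> decidable Q -> decidable (fun x => P x \/ Q x).
Proof.
  intros (f & Cf & Hf) (g & Cg & Hg); exists (fun x => f x * g x); split.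
  - now apply computable_mul.
  - intros x; rewrite Hf, Hg; nia.
Qed.

Lemma decidable_imp (P Q : nat -> Prop) :
  decidable P -> decidable Q -> decidable (fun x => P x -> Q x).
Proof.
  intros HP HQ; apply decidable_ext with (fun x => ~ P x \/ Q x).
  - intros x; tauto.
  - apply decidable_or; [now apply decidable_not | exact HQ].
Qed.

Lemma decidable_le (f g : nat -> nat) :
  computable f -> computable g -> decidable (fun x => f x <= g x).
Proof.
  intros Hf Hg; exists (fun x => f x - g x); split; [now apply computable_sub |].
  intros x; lia.
Qed.

Lemma decidable_lt (f g : nat -> nat) :
  computable f -> computable g -> decidable (fun x => f x < g x).
Proof. intros Hf Hg; apply (decidable_le (fun x => S (f x)) g); auto using computable_succ. Qed.

Lemma decidable_eq (f g : nat -> nat) :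
  computable f -> computable g -> decidable (fun x => f x = g x).
Proof.
  intros Hf Hg; exists (fun x => (f x - g x) + (g x - f x)); split.
  - apply computable_add; now apply computable_sub.
  - intros x; lia.
Qed.

Lemma decidable_ball (b : nat -> nat) (P : nat -> nat -> Prop) :
  computable b -> decidable (fun z => P (pi1 z) (pi2 z)) ->
  decidable (fun x => forall k, k < b x -> P x k).
Proof.
  intros Cb (f & Cf & Hf).
  exists (fun x => nat_rect (fun _ => nat) 0 (fun m r => r + f ⟨x, m⟩) (b x)); split.
  - apply (computable_rec (fun _ => 0) b (fun x m r => r + f ⟨x, m⟩)); auto.
    + apply computable_const.
    + apply computable_add; [apply computable_pi2, computable_pi2, computable_id |].
      apply (computable_comp f); auto.
      apply computable_pair; auto using computable_pi1, computable_pi2, computable_id.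
  - intros x; induction (b x) as [|m IH]; cbn [nat_rect].
    + split; [reflexivity | lia].
    + assert (E : P x m <-> f ⟨x, m⟩ = 0)
        by (rewrite <- Hf, pi1_pair, pi2_pair; reflexivity).
      split.
      * intros H; assert (H1 := proj1 E (H m (Nat.lt_succ_diag_r m))).
        assert (H2 := proj1 IH (fun k L => H k (Nat.lt_lt_succ_r _ _ L))); lia.
      * intros H k L.
        destruct (Nat.eq_dec k m) as [-> | N]; [apply E; lia | apply IH; lia].
Qed.

Lemma decidable_bex (b : nat -> nat) (P : nat -> nat -> Prop) :
  computable b -> decidable (fun z => P (pi1 z) (pi2 z)) ->
  decidable (fun x => exists k, k < b x /\ P x k).
Proof.
  intros Cb HP.
  apply decidable_ext with (fun x => ~ (forall k, k < b x -> ~ P x k)).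
  - intros x; split.
    + intros H; apply NNPP; intros N; apply H; intros k L Pk; apply N; eauto.
    + intros (k & L & Pk) H; exact (H k L Pk).
  - apply decidable_not, (decidable_ball b (fun x k => ~ P x k)); auto.
    now apply decidable_not.
Qed.

Lemma decidable_finset (u f : nat -> nat) :
  computable u -> computable f -> decidable (fun x => finset_of (u x) (f x)).
Proof.
  intros Cu Cf.
  apply (decidable_ext _ _ (fun x => iff_sym (finset_testbit (u x) (f x)))).
  apply (decidable_bex (fun x => S (u x)) (fun x q => exists r, r < S (u x) /\
    r < 2 ^ f x /\ u x = (2 * q + 1) * 2 ^ f x + r)); [now apply computable_succ |].
  apply (decidable_bex (fun z => S (u (pi1 z))) (fun z r =>
    r < 2 ^ f (pi1 z) /\ u (pi1 z) = (2 * (pi2 z) + 1) * 2 ^ f (pi1 z) + r)).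
  - apply computable_succ, (computable_comp u); auto using computable_pi1, computable_id.
  - assert (C : forall h, computable h -> computable (fun z => h (pi1 (pi1 z)))).
    { intros h Hh; apply (computable_comp h); auto using computable_pi1, computable_id. }
    assert (C2 : computable (fun z => 2 ^ f (pi1 (pi1 z))))
      by (apply computable_pow; auto).
    apply decidable_and.
    + apply decidable_lt; auto using computable_pi2, computable_id.
    + apply decidable_eq; auto.
      apply computable_add; [| auto using computable_pi2, computable_id].
      apply computable_mul; auto.
      apply computable_add; [| apply computable_const].
      apply computable_mul; auto using computable_const, computable_pi1, computable_pi2, computable_id.
Qed.

Lemma decidable_finset_ball (u : nat -> nat) (P : nat -> nat -> Prop) :
  computable u -> decidable (fun z => P (pi1 z) (pi2 z)) ->
  decidable (fun x => forall y, finset_of (u x) y -> P x y).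
Proof.
  intros Cu HP.
  apply decidable_ext with (fun x => forall y, y < u x -> finset_of (u x) y -> P x y).
  - intros x; split; intros H y; [intros F; apply H; auto; now apply finset_lt | auto].
  - apply (decidable_ball u (fun x y => finset_of (u x) y -> P x y)); auto.
    apply decidable_imp; auto.
    apply decidable_finset; auto using computable_pi2, computable_id.
    apply (computable_comp u); auto using computable_pi1, computable_id.
Qed.

(** The known operations are matched first; only then is the head taken as an arbitrary function
    whose computability is sought among the hypotheses. *)
Ltac computability :=
  cbv beta;
  lazymatch goal with
  | |- computable (fun x => x) => exact computable_id
  | |- computable (fun _ => ?c) => exact (computable_const c)
  | |- computable (fun x => pi1 (@?f x)) => apply (computable_pi1 f); computability
  | |- computable (fun x => pi2 (@?f x)) => apply (computable_pi2 f); computability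
  | |- computable (fun x => Cantor.to_nat (@?f x, @?g x)) =>
      apply (computable_pair f g); computability
  | |- computable (fun x => S (@?f x)) => apply (computable_succ f); computability
  | |- computable (fun x => @?f x + @?g x) => apply (computable_add f g); computability
  | |- computable (fun x => @?f x * @?g x) => apply (computable_mul f g); computability
  | |- computable (fun x => @?f x - @?g x) => apply (computable_sub f g); computability
  | |- computable (fun x => ?k ^ @?f x) => apply (computable_pow k f); computability
  | |- computable (fun x => ?h (@?f x)) =>
      apply (computable_comp h f); [assumption | computability]
  | |- computable _ => assumption
  end.

Ltac decidability :=
  cbv beta;
  lazymatch goal with
  | |- decidable (fun x => @?P x /\ @?Q x) => apply (decidable_and P Q); decidability
  | |- decidable (fun x => @?P x \/ @?Q x) => apply (decidable_or P Q); decidability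
  | |- decidable (fun x => ~ @?P x) => apply (decidable_not P); decidability
  | |- decidable (fun x => @?f x = @?g x) => apply (decidable_eq f g); computability
  | |- decidable (fun x => @?f x < @?g x) => apply (decidable_lt f g); computability
  | |- decidable (fun x => @?f x <= @?g x) => apply (decidable_le f g); computability
  | |- decidable (fun x => finset_of (@?u x) (@?f x)) =>
      apply (decidable_finset u f); computability
  | |- decidable (fun x => forall y, finset_of (@?u x) y -> @?P x y) =>
      apply (decidable_finset_ball u P); [computability | decidability]
  | |- decidable (fun x => forall k, k < @?b x -> @?P x k) =>
      apply (decidable_ball b P); [computability | decidability]
  | |- decidable (fun x => exists k, k < @?b x /\ @?P x k) =>
      apply (decidable_bex b P); [computability | decidability]
  | |- decidable (fun x => @?P x -> @?Q x) => apply (decidable_imp P Q); decidability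
  | |- decidable (fun x => ?P (@?f x) (@?g x)) =>
      apply (decidable_comp2 P f g); [assumption | computability | computability]
  | |- decidable (fun x => ?W (@?f x)) =>
      apply (decidable_comp W f); [assumption | computability]
  | |- decidable _ => assumption
  end.

(** * A universal program *)

(* A halting computation is witnessed by a finite set of triples (program,
   input, output) each of which follows from others by one clause of [eval]. *)
Definition eval_rule (u e x y : nat) : Prop :=
  (e = ⟨0, 0⟩ /\ y = 0) \/
  (e = ⟨0, 1⟩ /\ y = S x) \/
  (e = ⟨0, 2⟩ /\ y = pi1 x) \/
  (e = ⟨0, 3⟩ /\ y = pi2 x) \/
  (pi1 e = 1 /\ exists a, a < u /\ exists b, b < u /\
     finset_of u ⟨pi1 (pi2 e), ⟨x, a⟩⟩ /\ finset_of u ⟨pi2 (pi2 e), ⟨x, b⟩⟩ /\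
     y = ⟨a, b⟩) \/
  (pi1 e = 2 /\ exists a, a < u /\
     finset_of u ⟨pi2 (pi2 e), ⟨x, a⟩⟩ /\ finset_of u ⟨pi1 (pi2 e), ⟨a, y⟩⟩) \/
  (pi1 e = 3 /\ pi2 x = 0 /\ finset_of u ⟨pi1 (pi2 e), ⟨pi1 x, y⟩⟩) \/
  (pi1 e = 3 /\ pi2 x <> 0 /\ exists r, r < u /\
     finset_of u ⟨e, ⟨⟨pi1 x, pi2 x - 1⟩, r⟩⟩ /\
     finset_of u ⟨pi2 (pi2 e), ⟨⟨pi1 x, ⟨pi2 x - 1, r⟩⟩, y⟩⟩) \/
  (pi1 e = 4 /\ finset_of u ⟨pi2 e, ⟨⟨x, y⟩, 0⟩⟩ /\
     forall k, k < y -> exists v, v < u /\ finset_of u ⟨pi2 e, ⟨⟨x, k⟩, S v⟩⟩).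

Definition derivation (u : nat) : Prop :=
  forall w, finset_of u w -> eval_rule u (pi1 w) (pi1 (pi2 w)) (pi2 (pi2 w)).

Lemma decidable_derivation : decidable derivation.
Proof. unfold derivation, eval_rule; decidability. Qed.

(** The witnesses in [eval_rule u] are bounded by the number [u]; this keeps the bounds valid when
    the set grows. *)
Lemma finset_le (u v : nat) : (forall y, finset_of u y -> finset_of v y) -> u <= v.
Proof.
  intros H.
  assert (E : Nat.lor u v = v).
  { apply Nat.bits_inj; intros y.
    specialize (H y); unfold finset_of in H; rewrite Nat.lor_spec.
    destruct (Nat.testbit u y), (Nat.testbit v y); cbn; auto.
    now symmetry; apply H. }
  rewrite <- E; clear.
  assert (L : Nat.ldiff u (Nat.lor u v) = 0).
  { apply Nat.bits_inj; intros y.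
    rewrite Nat.ldiff_spec, Nat.lor_spec, Nat.bits_0.
    now destruct (Nat.testbit u y), (Nat.testbit v y). }
  now apply Nat.ldiff_le.
Qed.

Lemma eval_rule_mono (u v e x y : nat) :
  (forall w, finset_of u w -> finset_of v w) ->
  eval_rule u e x y -> eval_rule v e x y.
Proof.
  intros S H; pose proof (finset_le _ _ S) as L; unfold eval_rule in *.
  destruct H as [H|[H|[H|[H|[H|[H|[H|[H|H]]]]]]]]; auto 12.
  - destruct H as (E & a & La & b & Lb & H1 & H2 & H3).
    do 4 right; left; split; auto.
    exists a; split; [lia |]; exists b; split; [lia |]; auto.
  - destruct H as (E & a & La & H1 & H2).
    do 5 right; left; split; auto; exists a; split; [lia | auto].
  - destruct H as (E & H1 & H2); do 6 right; left; auto.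
  - destruct H as (E & N & r & Lr & H1 & H2).
    do 7 right; left; repeat split; auto; exists r; split; [lia | auto].
  - destruct H as (E & H1 & H2).
    do 8 right; repeat split; auto; intros k Lk.
    destruct (H2 k Lk) as (a & La & Ha); exists a; split; [lia | auto].
Qed.

Lemma derivation_union (u v : nat) :
  derivation u -> derivation v -> derivation (Nat.lor u v).
Proof.
  intros Du Dv w Hw; apply finset_union in Hw; destruct Hw as [Hw | Hw].
  - apply (eval_rule_mono u); auto; intros; apply finset_union; auto.
  - apply (eval_rule_mono v); auto; intros; apply finset_union; auto.
Qed.

Lemma derivation_add (u e x y : nat) :
  derivation u -> eval_rule u e x y ->
  exists v, derivation v /\ finset_of v ⟨e, ⟨x, y⟩⟩.
Proof.
  intros D H; exists (Nat.lor u (2 ^ ⟨e, ⟨x, y⟩⟩)).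
  assert (S : forall w, finset_of u w -> finset_of (Nat.lor u (2 ^ ⟨e, ⟨x, y⟩⟩)) w)
    by (intros; apply finset_union; auto).
  split.
  - intros w Hw; apply finset_union in Hw; destruct Hw as [Hw | Hw].
    + exact (eval_rule_mono _ _ _ _ _ S (D w Hw)).
    + apply finset_single in Hw; subst w; repeat rewrite ?pi1_pair, ?pi2_pair.
      exact (eval_rule_mono _ _ _ _ _ S H).
  - apply finset_union; right; now apply finset_single.
Qed.

(** The bounds in [eval_rule], present for decidability, therefore exclude no genuine witness. *)
Lemma finset_output_lt (u e x y : nat) : finset_of u ⟨e, ⟨x, y⟩⟩ -> y < u.
Proof.
  intros H; apply finset_lt in H.
  pose proof (pi2_le ⟨e, ⟨x, y⟩⟩) as A; pose proof (pi2_le ⟨x, y⟩) as B.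
  rewrite pi2_pair in A, B; lia.
Qed.

Definition derivable (e x y : nat) : Prop :=
  exists u, derivation u /\ finset_of u ⟨e, ⟨x, y⟩⟩.

(** A derivation cannot be circular: each premise concerns a subprogram, or the same [Prec] program
    with a smaller counter. Induction on the program, with an inner induction on the counter, is
    thus enough. *)
Lemma derivable_sound (c : code) :
  forall x y, derivable (encode c) x y -> eval c x y.
Proof.
  enough (G : forall u, derivation u ->
    forall x y, finset_of u ⟨encode c, ⟨x, y⟩⟩ -> eval c x y)
    by (intros x y (u & D & H); eauto).
  intros u D.
  assert (R : forall d x y, finset_of u ⟨encode d, ⟨x, y⟩⟩ ->
    eval_rule u (encode d) x y).
  { intros d x y H; apply D in H; now repeat rewrite ?pi1_pair, ?pi2_pair in H. }
  induction c as [| | | | c1 IH1 c2 IH2 | c1 IH1 c2 IH2 | c1 IH1 c2 IH2 | c IH].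
  (* The [Prec] case comes first, as it alone needs the inner induction on the counter. *)
  7: {
    intros x; cbn [eval]; fold (pi1 x); fold (pi2 x).
    remember (pi2 x) as m eqn:Em; symmetry in Em.
    revert x Em; induction m as [|m IHm]; intros x Em y H; pose proof (R _ _ _ H) as Hr;
      unfold eval_rule in Hr; cbn [encode] in Hr;
      repeat rewrite ?pair_eq, ?pi1_pair, ?pi2_pair in Hr; rewrite Em in Hr;
      destruct Hr as [Hr|[Hr|[Hr|[Hr|[Hr|[Hr|[Hr|[Hr|Hr]]]]]]]]; try lia;
      cbn [prec_graph].
    - destruct Hr as (_ & _ & H1); auto.
    - destruct Hr as (_ & _ & r & _ & H1 & H2).
      replace (S m - 1) with m in H1, H2 by lia.
      exists r; split; [| auto].
      specialize (IHm ⟨pi1 x, m⟩ (pi2_pair _ _) r H1).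
      now rewrite pi1_pair in IHm. }
  all: intros x y H; pose proof (R _ _ _ H) as Hr;
    unfold eval_rule in Hr; cbn [encode] in Hr;
    repeat rewrite ?pair_eq, ?pi1_pair, ?pi2_pair in Hr;
    destruct Hr as [Hr|[Hr|[Hr|[Hr|[Hr|[Hr|[Hr|[Hr|Hr]]]]]]]]; try lia; cbn [eval].
  - lia.
  - lia.
  - now destruct Hr.
  - now destruct Hr.
  - destruct Hr as (_ & a & _ & b & _ & H1 & H2 & H3); exists a, b; auto.
  - destruct Hr as (_ & a & _ & H1 & H2); exists a; auto.
  - destruct Hr as (_ & H1 & H2); split; auto.
    intros k L; destruct (H2 k L) as (v & _ & Hv); eauto.
Qed.

Lemma derivable_complete (c : code) :
  forall x y, eval c x y -> derivable (encode c) x y.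
Proof.
  (* Rules without premises hold over the empty set, whose canonical index is 0. *)
  assert (A : forall e x y, eval_rule 0 e x y -> derivable e x y).
  { intros e x y; apply derivation_add; intros w H; now apply finset_empty in H. }
  induction c as [| | | | c1 IH1 c2 IH2 | c1 IH1 c2 IH2 | c1 IH1 c2 IH2 | c IH];
    intros x y; cbn [eval encode].
  - intros H; apply A; unfold eval_rule; auto.
  - intros H; apply A; unfold eval_rule; auto.
  - intros H; apply A; unfold eval_rule; auto 6.
  - intros H; apply A; unfold eval_rule; auto 6.
  - intros (a & b & Ha & Hb & ->).
    destruct (IH1 _ _ Ha) as (u & Du & Hu), (IH2 _ _ Hb) as (v & Dv & Hv).
    apply (derivation_add (Nat.lor u v)); [now apply derivation_union |].
    assert (Hu' : finset_of (Nat.lor u v) ⟨encode c1, ⟨x, a⟩⟩) by (apply finset_union; auto).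
    assert (Hv' : finset_of (Nat.lor u v) ⟨encode c2, ⟨x, b⟩⟩) by (apply finset_union; auto).
    do 4 right; left; repeat rewrite ?pi1_pair, ?pi2_pair; split; auto.
    exists a; split; [eapply finset_output_lt; eauto |].
    exists b; split; [eapply finset_output_lt; eauto | auto].
  - intros (a & Ha & Hb).
    destruct (IH2 _ _ Ha) as (u & Du & Hu), (IH1 _ _ Hb) as (v & Dv & Hv).
    apply (derivation_add (Nat.lor u v)); [now apply derivation_union |].
    assert (Hu' : finset_of (Nat.lor u v) ⟨encode c2, ⟨x, a⟩⟩) by (apply finset_union; auto).
    assert (Hv' : finset_of (Nat.lor u v) ⟨encode c1, ⟨a, y⟩⟩) by (apply finset_union; auto).
    do 5 right; left; repeat rewrite ?pi1_pair, ?pi2_pair; split; auto.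
    exists a; split; [eapply finset_output_lt; eauto | auto].
  - fold (pi1 x); fold (pi2 x).
    remember (pi2 x) as m eqn:Em; symmetry in Em.
    revert x Em y; induction m as [|m IHm]; intros x Em y; cbn [prec_graph].
    + intros H; destruct (IH1 _ _ H) as (u & Du & Hu).
      apply (derivation_add u); auto.
      do 6 right; left; repeat rewrite ?pi1_pair, ?pi2_pair; auto.
    + intros (r & Hr & Hy).
      destruct (IHm ⟨pi1 x, m⟩ (pi2_pair _ _) r) as (u & Du & Hu);
        [now rewrite pi1_pair |].
      destruct (IH2 _ _ Hy) as (v & Dv & Hv).
      apply (derivation_add (Nat.lor u v)); [now apply derivation_union |].
      assert (Hu' := proj2 (finset_union u v _) (or_introl Hu)).
      assert (Hv' := proj2 (finset_union u v _) (or_intror Hv)).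
      do 7 right; left; repeat rewrite ?pi1_pair, ?pi2_pair.
      repeat split; [lia |].
      exists r; split; [eapply finset_output_lt; eauto |].
      replace (pi2 x - 1) with m by lia; auto.
  - intros [Hy Hk].
    (* The derivations for all arguments tried before the zero at [y] are merged into one finite
       set. *)
    assert (G : forall b, b <= y -> exists u, derivation u /\
      forall k, k < b -> exists v, finset_of u ⟨encode c, ⟨⟨x, k⟩, S v⟩⟩).
    { induction b as [|b IHb]; intros L.
      - exists 0; split; [intros w H; now apply finset_empty in H | lia].
      - destruct IHb as (u & Du & Hu); [lia |].
        destruct (Hk b L) as (v & Hv); destruct (IH _ _ Hv) as (u' & Du' & Hu').
        exists (Nat.lor u u'); split; [now apply derivation_union |].
        intros k Lk; destruct (Nat.eq_dec k b) as [-> | N].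
        + exists v; apply finset_union; auto.
        + destruct (Hu k) as (v' & Hv'); [lia |]; exists v'; apply finset_union; auto. }
    destruct (G y (le_n y)) as (u & Du & Hu), (IH _ _ Hy) as (u' & Du' & Hu').
    apply (derivation_add (Nat.lor u u')); [now apply derivation_union |].
    do 8 right; repeat rewrite ?pi1_pair, ?pi2_pair; repeat split.
    + apply finset_union; auto.
    + intros k L; destruct (Hu k L) as (v & Hv); exists v.
      assert (Hv' := proj2 (finset_union u u' _) (or_introl Hv)).
      split; [apply finset_output_lt in Hv'; lia | exact Hv'].
Qed.

(** A finite set closed under immediate subprograms, certifying that its members are program
    numbers; [ce_nth] is empty at all other indices. *)
Definition code_derivation (u : nat) : Prop :=
  forall e, finset_of u e ->
    (pi1 e = 0 /\ pi2 e < 4) \/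
    ((pi1 e = 1 \/ pi1 e = 2 \/ pi1 e = 3) /\
       finset_of u (pi1 (pi2 e)) /\ finset_of u (pi2 (pi2 e))) \/
    (pi1 e = 4 /\ finset_of u (pi2 e)).

Lemma decidable_code_derivation : decidable code_derivation.
Proof. unfold code_derivation; decidability. Qed.

Lemma code_derivation_union (u v : nat) :
  code_derivation u -> code_derivation v -> code_derivation (Nat.lor u v).
Proof.
  intros Du Dv w Hw; rewrite !finset_union in *.
  destruct Hw as [Hw | Hw]; [destruct (Du w Hw) | destruct (Dv w Hw)]; tauto.
Qed.

Lemma code_derivation_add (u e : nat) :
  code_derivation u ->
  (pi1 e = 0 /\ pi2 e < 4) \/
  ((pi1 e = 1 \/ pi1 e = 2 \/ pi1 e = 3) /\
     finset_of u (pi1 (pi2 e)) /\ finset_of u (pi2 (pi2 e))) \/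
  (pi1 e = 4 /\ finset_of u (pi2 e)) ->
  exists v, code_derivation v /\ finset_of v e.
Proof.
  intros D H; exists (Nat.lor u (2 ^ e)); split.
  - intros w Hw; rewrite !finset_union in *; rewrite finset_single in Hw.
    destruct Hw as [Hw | ->]; [destruct (D w Hw) |]; tauto.
  - apply finset_union; right; now apply finset_single.
Qed.

(** From right to left the program is rebuilt by strong induction on [e], as the components of a
    compound number are smaller than the number. *)
Lemma code_derivation_spec (e : nat) :
  (exists c, encode c = e) <-> exists u, code_derivation u /\ finset_of u e.
Proof.
  split.
  - intros (c & <-).
    assert (A : forall e, pi1 e = 0 /\ pi2 e < 4 ->
      exists u, code_derivation u /\ finset_of u e).
    { intros d Hd; apply (code_derivation_add 0); [| left; exact Hd].
      intros w H; now apply finset_empty in H. }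
    assert (B : forall c1 c2,
      (exists u, code_derivation u /\ finset_of u (encode c1)) ->
      (exists u, code_derivation u /\ finset_of u (encode c2)) ->
      forall k, k = 1 \/ k = 2 \/ k = 3 -> exists u, code_derivation u /\
        finset_of u ⟨k, ⟨encode c1, encode c2⟩⟩).
    { intros c1 c2 (u & Du & Hu) (v & Dv & Hv) k Hk.
      apply (code_derivation_add (Nat.lor u v)); [now apply code_derivation_union |].
      repeat rewrite ?pi1_pair, ?pi2_pair; rewrite !finset_union; right; left; tauto. }
    induction c as [| | | | c1 IH1 c2 IH2 | c1 IH1 c2 IH2 | c1 IH1 c2 IH2 | c IH];
      cbn [encode]; try (apply B; auto; fail);
      try (apply A; rewrite pi1_pair, pi2_pair; lia).
    destruct IH as (u & Du & Hu).
    apply (code_derivation_add u); auto.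
    rewrite pi1_pair, pi2_pair; auto.
  - intros (u & Du & Hu); revert Hu.
    induction e as [e IH] using lt_wf_ind; intros He.
    destruct (Du e He) as [[H1 H2] | [(H1 & H2 & H3) | [H1 H2]]].
    + assert (pi2 e = 0 \/ pi2 e = 1 \/ pi2 e = 2 \/ pi2 e = 3) as H by lia.
      rewrite <- (pair_pi e), H1.
      destruct H as [-> | [-> | [-> | ->]]];
        [exists Zero | exists Succ | exists Left | exists Right]; reflexivity.
    + assert (L : pi2 e < e) by (apply pi2_lt; lia).
      pose proof (pi1_le (pi2 e)); pose proof (pi2_le (pi2 e)).
      destruct (IH (pi1 (pi2 e))) as (c1 & E1); auto; [lia |].
      destruct (IH (pi2 (pi2 e))) as (c2 & E2); auto; [lia |].
      rewrite <- (pair_pi e), <- (pair_pi (pi2 e)), <- E1, <- E2.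
      destruct H1 as [-> | [-> | ->]];
        [exists (Pair c1 c2) | exists (Comp c1 c2) | exists (Prec c1 c2)]; reflexivity.
    + assert (L : pi2 e < e) by (apply pi2_lt; lia).
      destruct (IH (pi2 e) L H2) as (c & E).
      exists (Mu c); cbn [encode]; rewrite E, <- H1; apply pair_pi.
Qed.

(** Kleene's normal form, uniform in [e]: [w] packs a certificate that [e] is a program number, a
    derivation, and the output. *)
Lemma ce_nth_derivable (e x : nat) :
  ce_nth e x <->
  exists w, (code_derivation (pi1 w) /\ finset_of (pi1 w) e) /\
    derivation (pi1 (pi2 w)) /\ finset_of (pi1 (pi2 w)) ⟨e, ⟨x, pi2 (pi2 w)⟩⟩.
Proof.
  split.
  - intros (c & Ec & y & Hy).
    destruct (proj1 (code_derivation_spec e) (ex_intro _ c Ec)) as (u & Hu).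
    destruct (derivable_complete c x y Hy) as (v & Hv).
    exists ⟨u, ⟨v, y⟩⟩; repeat rewrite ?pi1_pair, ?pi2_pair; rewrite <- Ec at 2; auto.
  - intros (w & Hu & Hv).
    destruct (proj2 (code_derivation_spec e) (ex_intro _ (pi1 w) Hu)) as (c & Ec).
    exists c; split; [exact Ec |].
    exists (pi2 (pi2 w)); apply derivable_sound; rewrite Ec; now exists (pi1 (pi2 w)).
Qed.

(** * Closure properties of c.e. sets *)

Lemma ce_of_projection (P : nat -> nat -> Prop) :
  decidable (fun z => P (pi1 z) (pi2 z)) -> ce (fun x => exists w, P x w).
Proof.
  intros (f & (c & Hc) & Hf); exists (encode (Mu c)); intros x.
  assert (E : forall w, P x w <-> f ⟨x, w⟩ = 0)
    by (intros w; rewrite <- Hf, pi1_pair, pi2_pair; reflexivity).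
  split.
  - intros Hw; exists (Mu c); split; [reflexivity |].
    destruct Hw as (w & Hw).
    (* [Mu] returns only a least zero, so an arbitrary witness is first replaced by the least
       one. *)
    enough (M : exists y, P x y /\ forall k, k < y -> ~ P x k).
    { destruct M as (y & Py & My); exists y; cbn [eval]; split.
      - rewrite <- (proj1 (E y) Py); apply Hc.
      - intros k L; exists (pred (f ⟨x, k⟩)).
        rewrite Nat.succ_pred; [apply Hc |].
        intros F; apply (My k L), E, F. }
    revert Hw; induction w as [w IH] using lt_wf_ind; intros Hw.
    destruct (classic (exists k, k < w /\ P x k)) as [(k & L & Pk) | N].
    + exact (IH k L Pk).
    + exists w; split; [exact Hw |]; intros k L Pk; apply N; eauto.
  - intros (d & Ed & y & Hy); apply encode_inj in Ed; subst d.
    destruct Hy as [Hy _]; exists y; apply E; exact (eval_det c _ _ _ (Hc _) Hy).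
Qed.

Lemma ce_projection (W : natset) :
  ce W <->
  exists P : nat -> nat -> Prop,
    decidable (fun z => P (pi1 z) (pi2 z)) /\ forall x, W x <-> exists w, P x w.
Proof.
  split.
  - intros (e & He).
    exists (fun x w => (code_derivation (pi1 w) /\ finset_of (pi1 w) e) /\
      derivation (pi1 (pi2 w)) /\ finset_of (pi1 (pi2 w)) ⟨e, ⟨x, pi2 (pi2 w)⟩⟩).
    split; [| intros x; rewrite He; apply ce_nth_derivable].
    pose proof decidable_derivation; pose proof decidable_code_derivation; decidability.
  - intros (P & HP & E).
    destruct (ce_of_projection P HP) as (e & He); exists e; intros x.
    now rewrite E.
Qed.

Lemma ce_ext (P Q : natset) : (forall x, P x <-> Q x) -> ce P -> ce Q.
Proof. intros E (e & He); exists e; intros x; now rewrite <- E. Qed.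

Lemma ce_universal : ce (fun z => ce_nth (pi1 z) (pi2 z)).
Proof.
  apply (ce_ext _ _ (fun z => iff_sym (ce_nth_derivable (pi1 z) (pi2 z)))).
  apply (ce_of_projection (fun z w => (code_derivation (pi1 w) /\ finset_of (pi1 w) (pi1 z)) /\
    derivation (pi1 (pi2 w)) /\
    finset_of (pi1 (pi2 w)) ⟨pi1 z, ⟨pi2 z, pi2 (pi2 w)⟩⟩)).
  pose proof decidable_derivation; pose proof decidable_code_derivation; decidability.
Qed.

Lemma ce_decidable (P : natset) : decidable P -> ce P.
Proof.
  intros HP; apply ce_ext with (fun x => exists _ : nat, P x).
  - intros x; split; [intros (_ & H); exact H | intros H; exists 0; exact H].
  - apply (ce_of_projection (fun x _ => P x)); decidability.
Qed.

Lemma ce_comp (W : natset) (f : nat -> nat) :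
  ce W -> computable f -> ce (fun x => W (f x)).
Proof.
  intros HW Cf; apply ce_projection in HW as (P & HP & E).
  apply ce_projection; exists (fun x => P (f x)); split; [| intros x; apply E].
  apply decidable_ext with
    (fun z => P (pi1 ⟨f (pi1 z), pi2 z⟩) (pi2 ⟨f (pi1 z), pi2 z⟩)).
  - intros z; now rewrite pi1_pair, pi2_pair.
  - apply (decidable_comp _ _ HP); computability.
Qed.

Lemma ce_comp2 (P : nat -> nat -> Prop) (f g : nat -> nat) :
  ce (fun z => P (pi1 z) (pi2 z)) -> computable f -> computable g ->
  ce (fun x => P (f x) (g x)).
Proof.
  intros HP Cf Cg.
  apply ce_ext with (fun x => P (pi1 ⟨f x, g x⟩) (pi2 ⟨f x, g x⟩)).
  - intros x; now rewrite pi1_pair, pi2_pair.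
  - apply (ce_comp (fun z => P (pi1 z) (pi2 z)) (fun x => ⟨f x, g x⟩)); auto.
    computability.
Qed.

Lemma ce_and (P Q : natset) : ce P -> ce Q -> ce (fun x => P x /\ Q x).
Proof.
  intros HP HQ; apply ce_projection in HP as (P' & HP & EP), HQ as (Q' & HQ & EQ).
  apply ce_projection; exists (fun x w => P' x (pi1 w) /\ Q' x (pi2 w)); split.
  - decidability.
  - intros x; rewrite EP, EQ; split.
    + intros [(v & Hv) (w & Hw)]; exists ⟨v, w⟩; now rewrite pi1_pair, pi2_pair.
    + intros (w & H1 & H2); eauto.
Qed.

Lemma ce_or (P Q : natset) : ce P -> ce Q -> ce (fun x => P x \/ Q x).
Proof.
  intros HP HQ; apply ce_projection in HP as (P' & HP & EP), HQ as (Q' & HQ & EQ).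
  apply ce_projection; exists (fun x w => P' x w \/ Q' x w); split.
  - now apply decidable_or.
  - intros x; rewrite EP, EQ; firstorder.
Qed.

Lemma ce_ex (P : nat -> nat -> Prop) :
  ce (fun z => P (pi1 z) (pi2 z)) -> ce (fun x => exists y, P x y).
Proof.
  intros HP; apply ce_projection in HP as (P' & HP & EP).
  apply ce_projection; exists (fun x w => P' ⟨x, pi1 w⟩ (pi2 w)); split.
  - decidability.
  - assert (E : forall x y, P x y <-> exists w, P' ⟨x, y⟩ w)
      by (intros x y; rewrite <- EP, pi1_pair, pi2_pair; reflexivity).
    intros x; split.
    + intros (y & Hy); apply E in Hy as (w & Hw); exists ⟨y, w⟩.
      now rewrite pi1_pair, pi2_pair.
    + intros (w & Hw); exists (pi1 w); apply E; eauto.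
Qed.

(** Finitely many witnesses have a common bound, which moves the unbounded quantifier to the
    front. *)
Lemma ce_ball (b : nat -> nat) (P : nat -> nat -> Prop) :
  computable b -> ce (fun z => P (pi1 z) (pi2 z)) ->
  ce (fun x => forall k, k < b x -> P x k).
Proof.
  intros Cb HP; apply ce_projection in HP as (P' & HP & EP).
  assert (E : forall x y, P x y <-> exists w, P' ⟨x, y⟩ w)
    by (intros x y; rewrite <- EP, pi1_pair, pi2_pair; reflexivity).
  apply ce_projection.
  exists (fun x c => forall k, k < b x -> exists w, w < c /\ P' ⟨x, k⟩ w); split.
  - decidability.
  - intros x; induction (b x) as [|m IH].
    + split; [exists 0; lia | lia].
    + split.
      * intros H; destruct (proj1 IH) as (c & Hc); [auto |].
        destruct (proj1 (E x m) (H m (Nat.lt_succ_diag_r m))) as (w & Hw).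
        exists (c + S w); intros k L.
        destruct (Nat.eq_dec k m) as [-> | N]; [exists w; split; [lia | auto] |].
        destruct (Hc k) as (w' & L' & Hw'); [lia |]; exists w'; split; [lia | auto].
      * intros (c & Hc) k L; apply E.
        destruct (Hc k L) as (w & _ & Hw); eauto.
Qed.

Lemma ce_imp (P Q : natset) : decidable P -> ce Q -> ce (fun x => P x -> Q x).
Proof.
  intros HP HQ; apply ce_ext with (fun x => ~ P x \/ Q x).
  - intros x; tauto.
  - apply ce_or; [apply ce_decidable, decidable_not |]; auto.
Qed.

Lemma ce_finset_ball (u : nat -> nat) (P : nat -> nat -> Prop) :
  computable u -> ce (fun z => P (pi1 z) (pi2 z)) ->
  ce (fun x => forall y, finset_of (u x) y -> P x y).
Proof.
  intros Cu HP.
  apply ce_ext with (fun x => forall y, y < u x -> finset_of (u x) y -> P x y).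
  - intros x; split; intros H y; [intros F; apply H; auto; now apply finset_lt | auto].
  - apply (ce_ball u (fun x y => finset_of (u x) y -> P x y)); auto.
    apply ce_imp; [decidability | exact HP].
Qed.

Ltac enumerability :=
  cbv beta;
  first
  [ assumption
  | apply ce_decidable; decidability
  | lazymatch goal with
    | |- ce (fun x => @?P x /\ @?Q x) => apply (ce_and P Q); enumerability
    | |- ce (fun x => @?P x \/ @?Q x) => apply (ce_or P Q); enumerability
    | |- ce (fun x => exists y, @?P x y) => apply (ce_ex P); enumerability
    | |- ce (fun x => forall y, finset_of (@?u x) y -> @?P x y) =>
        apply (ce_finset_ball u P); [computability | enumerability]
    | |- ce (fun x => forall k, k < @?b x -> @?P x k) =>
        apply (ce_ball b P); [computability | enumerability]
    | |- ce (fun x => @?P x -> @?Q x) =>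
        apply (ce_imp P Q); [decidability | enumerability]
    | |- ce (fun x => ce_nth (@?e x) (@?f x)) =>
        apply (ce_comp2 ce_nth e f ce_universal); computability
    | |- ce (fun x => ?P (@?f x) (@?g x)) =>
        apply (ce_comp2 P f g); [assumption | computability | computability]
    | |- ce (fun x => ?W (@?f x)) =>
        apply (ce_comp W f); [assumption | computability]
    end ].

(* Among the pairs (y, witness) for [R x y], take the least one. *)
Lemma ce_uniformization (R : nat -> nat -> Prop) :
  ce (fun z => R (pi1 z) (pi2 z)) ->
  exists S : nat -> nat -> Prop,
    ce (fun z => S (pi1 z) (pi2 z)) /\
    (forall x y, S x y -> R x y) /\
    (forall x y y', S x y -> S x y' -> y = y') /\
    (forall x y, R x y -> exists y', S x y').
Proof.
  intros HR; apply ce_projection in HR as (P & HP & E).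
  assert (ER : forall x y, R x y <-> exists w, P ⟨x, y⟩ w)
    by (intros x y; rewrite <- E, pi1_pair, pi2_pair; reflexivity).
  exists (fun x y => exists w, P ⟨x, pi1 w⟩ (pi2 w) /\ y = pi1 w /\
    forall v, v < w -> ~ P ⟨x, pi1 v⟩ (pi2 v)).
  repeat split.
  - apply (ce_of_projection (fun z w => P ⟨pi1 z, pi1 w⟩ (pi2 w) /\ pi2 z = pi1 w /\
      forall v, v < w -> ~ P ⟨pi1 z, pi1 v⟩ (pi2 v))).
    decidability.
  - intros x y (w & Hw & -> & _); apply ER; eauto.
  - intros x y y' (w & Hw & -> & Mw) (w' & Hw' & -> & Mw').
    destruct (Nat.lt_trichotomy w w') as [L | [-> | L]]; auto.
    + now destruct (Mw' _ L).
    + now destruct (Mw _ L).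
  - intros x y Hy; apply ER in Hy as (v & Hv).
    assert (G : exists w, P ⟨x, pi1 w⟩ (pi2 w))
      by (exists ⟨y, v⟩; now rewrite pi1_pair, pi2_pair).
    destruct G as (w & Hw).
    induction w as [w IH] using lt_wf_ind.
    destruct (classic (exists k, k < w /\ P ⟨x, pi1 k⟩ (pi2 k))) as [(k & L & Pk) | N].
    + exact (IH k L Pk).
    + exists (pi1 w), w; repeat split; auto; intros k L Pk; apply N; eauto.
Qed.

(** * Enumeration reducibility *)

Lemma enum_op_mono (W A B : natset) :
  (forall x, A x -> B x) -> forall x, enum_op W A x -> enum_op W B x.
Proof. intros S x (u & Hu & Du); exists u; auto. Qed.

Lemma le_e_join (X Y Z : natset) : le_e X Z -> le_e Y Z -> le_e (join X Y) Z.
Proof.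
  intros (V & HV & EV) (W & HW & EW).
  exists (fun z => (exists x, pi1 z = 2 * x /\ V ⟨x, pi2 z⟩) \/
    (exists y, pi1 z = 2 * y + 1 /\ W ⟨y, pi2 z⟩)); split; [enumerability |].
  intros z; unfold join, enum_op.
  setoid_rewrite pi1_pair; setoid_rewrite pi2_pair; split.
  - intros [(x & Hx & E) | (y & Hy & E)].
    + apply EV in Hx as (u & Hu); exists u; split; [left; exists x |]; tauto.
    + apply EW in Hy as (u & Hu); exists u; split; [right; exists y |]; tauto.
  - intros (u & [(x & E & Hx) | (y & E & Hy)] & Du).
    + left; exists x; split; auto; apply EV; exists u; auto.
    + right; exists y; split; auto; apply EW; exists u; auto.
Qed.

Lemma le_e_union (X Y Z : natset) :
  le_e X Z -> le_e Y Z -> le_e (fun x => X x \/ Y x) Z.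
Proof.
  intros (V & HV & EV) (W & HW & EW).
  exists (fun z => V z \/ W z); split; [enumerability |].
  intros x; rewrite EV, EW; unfold enum_op; firstorder.
Qed.

Lemma le_e_restrict (P X Z : natset) :
  decidable P -> le_e X Z -> le_e (fun x => X x /\ P x) Z.
Proof.
  intros HP (W & HW & EW).
  exists (fun z => W z /\ P (pi1 z)); split; [enumerability |].
  intros x; rewrite EW; unfold enum_op; setoid_rewrite pi1_pair; firstorder.
Qed.

Lemma le_e_refl (X : natset) : le_e X X.
Proof.
  exists (fun z => pi2 z = 2 ^ pi1 z); split; [enumerability |].
  intros x; unfold enum_op; setoid_rewrite pi1_pair; setoid_rewrite pi2_pair; split.
  - intros H; exists (2 ^ x); split; auto; intros y Hy; apply finset_single in Hy; now subst.
  - intros (u & -> & H); apply H; now apply finset_single.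
Qed.

(** Over the empty oracle only axioms with empty condition apply, and 0 is the index of the empty
    set. So [K] of the empty set is a universal c.e. set, and the odd half of [zero_jump] lists the
    negations of c.e. facts. *)
Lemma K_empty (e z : nat) : K (fun _ => False) ⟨e, z⟩ <-> ce_nth e ⟨z, 0⟩.
Proof.
  split.
  - intros (e' & x & E & u & Hu & Du); apply Cantor.to_nat_inj in E; injection E as -> ->.
    replace 0 with u; auto.
    apply Nat.bits_inj; intros y; rewrite Nat.bits_0.
    destruct (Nat.testbit u y) eqn:B; auto; destruct (Du y B).
  - intros H; exists e, z; split; auto; exists 0; split; auto.
    intros y Hy; now apply finset_empty in Hy.
Qed.

(** Every set of this existential form over c.e. facts and their negations is reducible to
    [zero_jump]: an axiom asks for the single odd element expressing the negation of [Q x w]. *)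
Lemma le_e_zero_jump (X : natset) (P Q : nat -> nat -> Prop) :
  ce (fun z => P (pi1 z) (pi2 z)) -> ce (fun z => Q (pi1 z) (pi2 z)) ->
  (forall x, X x <-> exists w, P x w /\ ~ Q x w) ->
  le_e X zero_jump.
Proof.
  intros HP HQ E.
  (* The dummy second coordinate lets a pair in [Q] be read as the element of an axiom, here with
     the empty set. *)
  assert (HQ' : ce (fun z => Q (pi1 (pi1 z)) (pi2 (pi1 z))))
    by enumerability.
  destruct HQ' as (e & He).
  assert (Z : forall x w, zero_jump (2 * ⟨e, ⟨x, w⟩⟩ + 1) <-> ~ Q x w).
  { intros x w; unfold zero_jump, jump, join, compl; split.
    - intros [(y & _ & F) | (y & Hy & F)]; [lia |].
      assert (y = ⟨e, ⟨x, w⟩⟩) as -> by lia.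
      rewrite K_empty, <- He in Hy.
      now repeat rewrite ?pi1_pair, ?pi2_pair in Hy.
    - intros N; right; exists ⟨e, ⟨x, w⟩⟩; split; auto.
      rewrite K_empty, <- He.
      now repeat rewrite ?pi1_pair, ?pi2_pair. }
  exists (fun z => exists w, P (pi1 z) w /\ pi2 z = 2 ^ (2 * ⟨e, ⟨pi1 z, w⟩⟩ + 1)); split.
  - enumerability.
  - intros x; rewrite E; unfold enum_op.
    setoid_rewrite pi1_pair; setoid_rewrite pi2_pair; split.
    + intros (w & Pw & Qw); exists (2 ^ (2 * ⟨e, ⟨x, w⟩⟩ + 1)); split; [eauto |].
      intros y Hy; apply finset_single in Hy; subst y; now apply Z.
    + intros (u & (w & Pw & ->) & H); exists w; split; auto.
      apply Z, H; now apply finset_single.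
Qed.

(** * Generic tuples of cuts *)

(* A number [⟨i, ⟨a, b⟩⟩] stands for the rational a/(b+1) in the [i]-th column. *)
Definition col_lt (y z : nat) : Prop :=
  pi1 y = pi1 z /\
  pi1 (pi2 y) * S (pi2 (pi2 z)) < pi1 (pi2 z) * S (pi2 (pi2 y)).

Definition col_le (y z : nat) : Prop :=
  pi1 y = pi1 z /\
  pi1 (pi2 y) * S (pi2 (pi2 z)) <= pi1 (pi2 z) * S (pi2 (pi2 y)).

Lemma col_lt_le (y z : nat) : col_lt y z -> col_le y z.
Proof. unfold col_lt, col_le; lia. Qed.

Lemma col_lt_irrefl (y : nat) : ~ col_lt y y.
Proof. unfold col_lt; lia. Qed.

Lemma col_lt_or_le (y z : nat) : pi1 y = pi1 z -> col_lt y z \/ col_le z y.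
Proof. unfold col_lt, col_le; lia. Qed.

Lemma col_le_lt_trans (x y z : nat) : col_le x y -> col_lt y z -> col_lt x z.
Proof.
  unfold col_lt, col_le; intros [E H] [E' H']; split; [congruence |].
  revert H H'; generalize (pi1 (pi2 x)), (pi2 (pi2 x)), (pi1 (pi2 y)), (pi2 (pi2 y)),
    (pi1 (pi2 z)), (pi2 (pi2 z)); intros a b c d e f H H'.
  (* The cross-multiplied inequalities chain after multiplication by the denominator [S d] of the
     middle rational. *)
  apply (Nat.mul_lt_mono_pos_l (S d)); nia.
Qed.

Lemma col_lt_le_trans (x y z : nat) : col_lt x y -> col_le y z -> col_lt x z.
Proof.
  unfold col_lt, col_le; intros [E H] [E' H']; split; [congruence |].
  revert H H'; generalize (pi1 (pi2 x)), (pi2 (pi2 x)), (pi1 (pi2 y)), (pi2 (pi2 y)),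
    (pi1 (pi2 z)), (pi2 (pi2 z)); intros a b c d e f H H'.
  apply (Nat.mul_lt_mono_pos_l (S d)); nia.
Qed.

(** [D] is an arbitrary set, so that the relation serves both for the finite part of a condition and
    for the whole tuple. *)
Definition below (n : nat) (D : natset) (E : nat) : Prop :=
  forall z, D z -> pi1 z < n /\ forall w, finset_of E w -> pi1 z = pi1 w -> col_lt z w.

(* A condition [⟨F, E⟩] promises that the cuts contain F and lie below E. *)
Definition valid (n p : nat) : Prop := below n (finset_of (pi1 p)) (pi2 p).

Definition extends (q p : nat) : Prop :=
  (forall z, finset_of (pi1 p) z -> finset_of (pi1 q) z) /\
  (forall z, finset_of (pi2 p) z -> finset_of (pi2 q) z).

Definition approximates (n : nat) (A : natset) (p : nat) : Prop :=
  (forall z, finset_of (pi1 p) z -> A z) /\ below n A (pi2 p).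

Definition avoids (n p : nat) (O : natset) : Prop :=
  forall q, valid n q -> extends q p -> ~ O q.

(** The number [⟨i, 0⟩] is the rational 0 in column [i], so no cut is empty. That the columns are
    downward closed without maximum is not postulated: it follows from the last clause. *)
Definition generic (n : nat) (A : natset) : Prop :=
  (forall z, A z -> pi1 z < n) /\
  (forall i, i < n -> A ⟨i, 0⟩) /\
  forall O, ce O ->
    (exists p, approximates n A p /\ O p) \/
    (exists p, approximates n A p /\ avoids n p O).

Lemma extends_refl (p : nat) : extends p p.
Proof. split; auto. Qed.

Lemma extends_trans (p q r : nat) : extends r q -> extends q p -> extends r p.
Proof. intros [? ?] [? ?]; split; auto. Qed.

Lemma extends_pair (F E p : nat) :
  extends ⟨Nat.lor (pi1 p) F, Nat.lor (pi2 p) E⟩ p.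
Proof.
  split; intros z H; rewrite ?pi1_pair, ?pi2_pair; apply finset_union; auto.
Qed.

Lemma below_union (n : nat) (D : natset) (E E' : nat) :
  below n D E -> below n D E' -> below n D (Nat.lor E E').
Proof.
  intros H H' z Dz; destruct (H z Dz) as [L H1], (H' z Dz) as [_ H2]; split; auto.
  intros w Hw; apply finset_union in Hw as [Hw | Hw]; auto.
Qed.

Lemma below_single (n : nat) (D : natset) (w : nat) :
  (forall z, D z -> pi1 z < n) -> (forall z, D z -> pi1 z = pi1 w -> col_lt z w) ->
  below n D (2 ^ w).
Proof.
  intros H H' z Dz; split; auto; intros w' Hw; apply finset_single in Hw; subst; auto.
Qed.

Lemma below_lor (n F F' E : nat) :
  below n (finset_of F) E -> below n (finset_of F') E ->
  below n (finset_of (Nat.lor F F')) E.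
Proof. intros H H' z Hz; apply finset_union in Hz as [Hz | Hz]; auto. Qed.

Lemma below_sub (n : nat) (D D' : natset) (E : nat) :
  (forall z, D' z -> D z) -> below n D E -> below n D' E.
Proof. intros S H z Hz; auto. Qed.

Lemma valid_pair (n F E : nat) : below n (finset_of F) E -> valid n ⟨F, E⟩.
Proof. unfold valid; now rewrite pi1_pair, pi2_pair. Qed.

Lemma approximates_valid (n : nat) (A : natset) (p : nat) :
  approximates n A p -> valid n p.
Proof. intros [H H']; exact (below_sub _ _ _ _ H H'). Qed.

Lemma approximates_finset (n : nat) (A : natset) (F : nat) :
  generic n A ->
  (forall z, finset_of F z -> A z) -> approximates n A ⟨F, 0⟩.
Proof.
  intros GA H; unfold approximates; rewrite pi1_pair, pi2_pair; split; auto.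
  intros z Hz; split; [now apply GA |].
  intros w Hw; now apply finset_empty in Hw.
Qed.

(** Two neighbourhoods of the same point intersect in a neighbourhood, given by componentwise union,
    and avoidance is inherited by extensions. *)
Lemma avoids_refine (n : nat) (A : natset) (O : natset) (p q : nat) :
  approximates n A p -> avoids n p O -> approximates n A q ->
  exists r, approximates n A r /\ extends r p /\ extends r q /\ avoids n r O.
Proof.
  intros [Fp Ep] Hp [Fq Eq].
  exists ⟨Nat.lor (pi1 p) (pi1 q), Nat.lor (pi2 p) (pi2 q)⟩.
  assert (X : extends ⟨Nat.lor (pi1 p) (pi1 q), Nat.lor (pi2 p) (pi2 q)⟩ p)
    by apply extends_pair.
  split; [| split; [exact X | split]].
  - unfold approximates; rewrite pi1_pair, pi2_pair; split; [| now apply below_union].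
    intros z Hz; apply finset_union in Hz as [Hz | Hz]; auto.
  - rewrite (Nat.lor_comm (pi1 p)), (Nat.lor_comm (pi2 p)); apply extends_pair.
  - intros r Vr Xr; apply Hp; auto; exact (extends_trans _ _ _ Xr X).
Qed.

(** A condition containing [z] stays valid when [y] is added, so no approximation of [A] avoids the
    conditions containing [y]. *)
Lemma generic_downward (n : nat) (A : natset) (y z : nat) :
  generic n A -> col_le y z -> A z -> A y.
Proof.
  intros GA L Az.
  destruct (proj2 (proj2 GA) (fun p => finset_of (pi1 p) y)) as [(p & [Hp _] & Oy) | (p & Hp & Ap)];
    [enumerability | auto | exfalso].
  destruct (avoids_refine n A _ p ⟨2 ^ z, 0⟩ Hp Ap) as (r & Hr & _ & [Xr _] & Ar).
  { apply approximates_finset; auto; intros w Hw; apply finset_single in Hw; now subst. }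
  apply (Ar ⟨Nat.lor (pi1 r) (2 ^ y), Nat.lor (pi2 r) 0⟩).
  - apply valid_pair; rewrite Nat.lor_0_r.
    apply below_lor; [now apply (approximates_valid n A) |].
    intros w Hw; apply finset_single in Hw; subst w.
    destruct Hr as [_ Er]; destruct (Er z Az) as [Lz Ez].
    destruct L as [Ec L']; split; [congruence |].
    intros w Hw Ew; apply (col_le_lt_trans _ z); [split; auto |].
    apply Ez; auto; congruence.
  - apply extends_pair.
  - rewrite pi1_pair; apply finset_union; right; now apply finset_single.
Qed.

Lemma generic_no_max (n : nat) (A : natset) (y : nat) :
  generic n A -> A y -> exists z, A z /\ col_lt y z.
Proof.
  intros GA Ay.
  destruct (proj2 (proj2 GA) (fun p => exists z, finset_of (pi1 p) z /\ col_lt y z))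
    as [(p & [Hp _] & z & Hz & L) | (p & Hp & Ap)];
    [unfold col_lt; enumerability | eauto | exfalso].
  destruct Hp as [Fp Ep].
  (* [N] exceeds all denominators in the upper part of [p], since elements of a finite set are below
     its index. The rational [z] is [y] plus 1/((b+1)N). A larger rational with denominator d
     exceeds [y] by at least 1/((b+1)d), so [z] stays below every promised bound. *)
  pose (N := S (pi2 p)); pose (a := pi1 (pi2 y)); pose (b := pi2 (pi2 y)).
  pose (z := ⟨pi1 y, ⟨a * N + 1, S b * N - 1⟩⟩).
  assert (Hz : pi1 z = pi1 y /\ pi1 (pi2 z) = a * N + 1 /\ S (pi2 (pi2 z)) = S b * N).
  { unfold z; repeat rewrite ?pi1_pair, ?pi2_pair; repeat split; unfold N; nia. }
  destruct Hz as (Z1 & Z2 & Z3).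
  destruct (Ep y Ay) as [Ly Ey].
  apply (Ap ⟨Nat.lor (pi1 p) (2 ^ z), Nat.lor (pi2 p) 0⟩).
  - apply valid_pair; rewrite Nat.lor_0_r.
    apply below_lor; [exact (below_sub _ _ _ _ Fp Ep) |].
    intros t Ht; apply finset_single in Ht; subst t; split; [congruence |].
    intros w Hw Ew; split; [exact Ew |].
    destruct (Ey w Hw) as [_ Lw]; [congruence |].
    assert (B : S (pi2 (pi2 w)) < N).
    { apply finset_lt in Hw; pose proof (pi2_le w); pose proof (pi2_le (pi2 w)).
      unfold N; lia. }
    rewrite Z2, Z3; fold a b in Lw; nia.
  - apply extends_pair.
  - exists z; split.
    + rewrite pi1_pair; apply finset_union; right; now apply finset_single.
    + split; [congruence |]; rewrite Z2, Z3; fold a b; unfold N; nia.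
Qed.

(** Iterates [generic_no_max] through [F]: whenever an element of the column is not yet below the
    current [z], a member of [A] above that element replaces [z]. *)
Lemma generic_above (n : nat) (A : natset) (y F : nat) :
  generic n A -> A y -> (forall t, finset_of F t -> A t) ->
  exists z, A z /\ col_lt y z /\
    forall t, finset_of F t -> pi1 t = pi1 y -> col_lt t z.
Proof.
  intros GA Ay HF.
  enough (G : forall b, exists z, A z /\ col_lt y z /\
    forall t, t < b -> finset_of F t -> pi1 t = pi1 y -> col_lt t z).
  { destruct (G F) as (z & Az & L & H); exists z; repeat split; auto; try apply L.
    all: apply H; auto; now apply finset_lt. }
  induction b as [|b (z & Az & L & H)].
  - destruct (generic_no_max n A y GA Ay) as (z & Az & L); exists z; repeat split; auto;
      try apply L; lia.
  - destruct (classic (finset_of F b /\ pi1 b = pi1 y /\ ~ col_lt b z)) as [(Fb & Eb & N) | N].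
    + destruct (generic_no_max n A b GA (HF b Fb)) as (z' & Az' & L').
      destruct (col_lt_or_le b z) as [C | C]; [destruct L; congruence | contradiction |].
      assert (Lz : col_lt z z') by exact (col_le_lt_trans _ _ _ C L').
      assert (T : forall t, col_lt t z -> col_lt t z')
        by (intros t Ht; exact (col_lt_le_trans _ _ _ Ht (col_lt_le _ _ Lz))).
      exists z'; split; [auto | split; [auto |]].
      intros t Lt Ft Et; destruct (Nat.eq_dec t b) as [-> | Nb]; auto.
      apply T, H; auto; lia.
    + exists z; split; [auto | split; [auto |]].
      intros t Lt Ft Et; destruct (Nat.eq_dec t b) as [-> | Nb].
      * apply NNPP; intros C; apply N; auto.
      * apply H; auto; lia.
Qed.

Definition column (A : natset) (i : nat) : natset := fun z => A z /\ pi1 z = i.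

Definition off_column (A : natset) (i : nat) : natset := fun z => A z /\ pi1 z <> i.

(** Consider the conditions that promise to keep some [z] out although their lower part already
    enumerates [z] through [W] without column [i]. Meeting them refutes the reduction. They cannot
    be avoided either: for [z] high in column [i], the axiom used for [z] involves only other
    columns, so its elements can be added while [z] is kept out. *)
Lemma off_column_not_ge (n : nat) (A : natset) (i : nat) :
  generic n A -> i < n -> ~ le_e A (off_column A i).
Proof.
  intros GA Li (W & HW & EW).
  destruct (proj2 (proj2 GA) (fun p => exists z, finset_of (pi2 p) z /\ exists v, W ⟨z, v⟩ /\
    forall y, finset_of v y -> finset_of (pi1 p) y /\ pi1 y <> i))
    as [(p & [Fp Ep] & z & Hz & v & Wv & Hv) | (p & [Fp Ep] & Ap)]; [enumerability | |].
  - assert (Az : A z).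
    { apply EW; exists v; split; auto; intros y Hy.
      destruct (Hv y Hy); split; auto. }
    exact (col_lt_irrefl z (proj2 (Ep z Az) z Hz eq_refl)).
  - destruct (generic_above n A ⟨i, 0⟩ (pi1 p) GA) as (z & Az & L & H);
      [now apply GA | exact Fp |].
    destruct (proj1 (EW z) Az) as (v & Wv & Hv).
    rewrite pi1_pair in H; assert (Ez : pi1 z = i)
      by (destruct L as [L _]; now rewrite pi1_pair in L).
    (* This extension excludes [z], which is in [A], so it does not approximate [A]; avoidance
       covers all valid extensions, not only those. *)
    apply (Ap ⟨Nat.lor (pi1 p) v, Nat.lor (pi2 p) (2 ^ z)⟩).
    + assert (S : forall y, finset_of (Nat.lor (pi1 p) v) y -> A y).
      { intros y Hy; apply finset_union in Hy as [Hy | Hy]; [auto | apply (Hv y Hy)]. }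
      apply valid_pair, below_union; [exact (below_sub _ _ _ _ S Ep) |].
      apply below_single; [intros y Hy; now apply GA, S |].
      intros y Hy E; apply finset_union in Hy as [Hy | Hy]; [apply H; auto; congruence |].
      destruct (Hv y Hy); congruence.
    + apply extends_pair.
    + exists z; rewrite pi1_pair, pi2_pair; split.
      { apply finset_union; right; now apply finset_single. }
      exists v; split; auto; intros y Hy; split; [apply finset_union; auto | apply (Hv y Hy)].
Qed.

(** * Columns are join-prime *)

(** For [k] equal to 0 or 1 this concerns the left or right half of the finite set [u], read as a
    subset of a join. The bound on [x] holds automatically and keeps the quantifier bounded. *)
Definition supported (W : natset) (k u : nat) (B : natset) : Prop :=
  forall x, x < u -> finset_of u (2 * x + k) -> enum_op W B x.

Lemma supported_mono (W : natset) (k u : nat) (B C : natset) :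
  (forall x, B x -> C x) -> supported W k u B -> supported W k u C.
Proof. intros S H x L Hx; exact (enum_op_mono _ _ _ S _ (H x L Hx)). Qed.

(** Finitely many elements use finitely many axioms; [d] is the union of their finite sets. *)
Lemma supported_compact (W : natset) (k u : nat) (A : natset) :
  supported W k u A ->
  exists d, (forall t, finset_of d t -> A t) /\ supported W k u (finset_of d).
Proof.
  intros H.
  enough (G : forall b, b <= u -> exists d, (forall t, finset_of d t -> A t) /\
    forall x, x < b -> finset_of u (2 * x + k) -> enum_op W (finset_of d) x) by exact (G u (le_n u)).
  induction b as [|b IH]; intros L.
  - exists 0; split; [intros t Ht; now apply finset_empty in Ht | lia].
  - destruct IH as (d & Ad & Hd); [lia |].
    destruct (classic (finset_of u (2 * b + k))) as [Hb | Nb].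
    + destruct (H b L Hb) as (v & Wv & Av); exists (Nat.lor d v); split.
      * intros t Ht; apply finset_union in Ht as [Ht | Ht]; auto.
      * intros x Lx Hx; destruct (Nat.eq_dec x b) as [-> | N].
        -- exists v; split; auto; intros t Ht; apply finset_union; auto.
        -- apply (enum_op_mono W (finset_of d)); [intros; apply finset_union; auto |].
           apply Hd; auto; lia.
    + exists d; split; auto; intros x Lx Hx.
      destruct (Nat.eq_dec x b) as [-> | N]; [contradiction | apply Hd; auto; lia].
Qed.

Lemma finset_join (B0 B1 : natset) (u : nat) :
  (forall y, finset_of u y -> join B0 B1 y) <->
  (forall x, x < u -> finset_of u (2 * x + 0) -> B0 x) /\
  (forall x, x < u -> finset_of u (2 * x + 1) -> B1 x).
Proof.
  split.
  - intros H; split; intros x _ Hx; destruct (H _ Hx) as [(y & Hy & E) | (y & Hy & E)];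
      try lia; replace x with y by lia; auto.
  - intros [H0 H1] y Hy; pose proof (finset_lt _ _ Hy) as L.
    destruct (Nat.Even_or_Odd y) as [[x E] | [x E]]; subst y.
    + left; exists x; split; auto; apply H0; [lia | now rewrite Nat.add_0_r].
    + right; exists x; split; auto; apply H1; auto; lia.
Qed.

(* An axiom need not use the exact [k]-half of [u]: any finite superset [v] will do. *)
Definition covers (k v u : nat) : Prop :=
  forall x, x < u -> finset_of u (2 * x + k) -> finset_of v x.

Lemma covers_exists (k u : nat) (B : natset) :
  (forall x, x < u -> finset_of u (2 * x + k) -> B x) ->
  exists v, covers k v u /\ forall x, finset_of v x -> B x.
Proof.
  intros H; destruct (finset_comprehension (fun x => finset_of u (2 * x + k)) u) as (v & Hv).
  exists v; split; intros x; rewrite Hv; [auto | intros [? ?]; auto].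
Qed.

(** Genericity is used twice: first against conditions that would falsify the reduction [G], which
    yields [Max], then for the sets [O z0]. Which of the two reductions exists is decided
    non-uniformly, by whether [O z0] is met for every [z0] in the column. *)
Lemma column_join_prime (n : nat) (A : natset) (i : nat) (B0 B1 : natset) :
  generic n A -> le_e B0 A -> le_e B1 A ->
  le_e (column A i) (join B0 B1) -> le_e (column A i) B0 \/ le_e (column A i) B1.
Proof.
  intros GA (W0 & HW0 & EW0) (W1 & HW1 & EW1) (G & HG & EG).
  assert (Sound : forall z u, G ⟨z, u⟩ -> supported W0 0 u A -> supported W1 1 u A -> A z).
  { intros z u Hz H0 H1; enough (column A i z) by apply H.
    apply EG; exists u; split; auto; apply finset_join; split; intros x L Hx.
    - apply EW0; auto.
    - apply EW1; auto. }
  (* These conditions keep [z] out while their lower part supports both halves of an axiom for [z].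
     By [Sound] none of them approximates [A]. *)
  destruct (proj2 (proj2 GA) (fun p => exists z, finset_of (pi2 p) z /\ exists u, G ⟨z, u⟩ /\
    supported W0 0 u (finset_of (pi1 p)) /\ supported W1 1 u (finset_of (pi1 p))))
    as [(p & [Fp Ep] & z & Hz & u & Gu & H0 & H1) | (p0 & [F0 E0] & A0)].
  { unfold supported, enum_op; enumerability. }
  { exfalso.
    assert (Az : A z) by (apply (Sound z u Gu);
      [exact (supported_mono _ _ _ _ _ Fp H0) | exact (supported_mono _ _ _ _ _ Fp H1)]).
    exact (col_lt_irrefl z (proj2 (Ep z Az) z Hz eq_refl)). }
  (* The supports of the two halves of an axiom for [z] cannot both lie below [z],
     else their union together with the promise to keep [z] out would be met. *)
  assert (Max : forall z u d0 d1, G ⟨z, u⟩ ->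
    (forall t, finset_of (pi1 p0) t -> pi1 t = pi1 z -> col_lt t z) ->
    below n (finset_of d0) (pi2 p0) -> below n (finset_of d1) (pi2 p0) ->
    supported W0 0 u (finset_of d0) -> supported W1 1 u (finset_of d1) ->
    exists t, (finset_of d0 t \/ finset_of d1 t) /\ col_le z t).
  { intros z u d0 d1 Gu Hz L0 L1 S0 S1; apply NNPP; intros N.
    assert (L : below n (finset_of (Nat.lor (pi1 p0) (Nat.lor d0 d1))) (pi2 p0)).
    { apply below_lor; [exact (below_sub _ _ _ _ F0 E0) | now apply below_lor]. }
    apply (A0 ⟨Nat.lor (pi1 p0) (Nat.lor d0 d1), Nat.lor (pi2 p0) (2 ^ z)⟩).
    - apply valid_pair, below_union; auto.
      apply below_single; [intros t Ht; now apply L |].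
      intros t Ht Et; rewrite !finset_union in Ht; destruct Ht as [Ht | Ht]; auto.
      destruct (col_lt_or_le t z Et) as [C | C]; auto; exfalso; eauto.
    - apply extends_pair.
    - exists z; rewrite pi1_pair, pi2_pair; split.
      { apply finset_union; right; now apply finset_single. }
      exists u; split; [auto | split].
      + apply (supported_mono _ _ _ (finset_of d0)); auto.
        intros t Ht; rewrite !finset_union; auto.
      + apply (supported_mono _ _ _ (finset_of d1)); auto.
        intros t Ht; rewrite !finset_union; auto. }
  (* Here the left support [d0] stays below [z] in its column and need only respect the promises of
     [p0]; it need not lie in [p]. The right support and [z] do lie in [p]. *)
  pose (O := fun z0 p => exists z u d0, G ⟨z, u⟩ /\ col_lt z0 z /\
    (forall t, finset_of (pi1 p0) t -> pi1 t = pi1 z -> col_lt t z) /\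
    finset_of (pi1 p) z /\ below n (finset_of d0) (pi2 p0) /\
    (forall t, finset_of d0 t -> pi1 t = pi1 z -> col_lt t z) /\
    supported W0 0 u (finset_of d0) /\ supported W1 1 u (finset_of (pi1 p))).
  assert (HO : forall z0, ce (O z0)).
  { intros z0; unfold O, supported, enum_op, below, col_lt; enumerability. }
  destruct (classic (forall z0, column A i z0 -> exists p, approximates n A p /\ O z0 p))
    as [Case1 | Case2].
  - right.
    exists (fun s => exists z u d0, pi1 z = i /\ col_le (pi1 s) z /\ G ⟨z, u⟩ /\
      (forall t, finset_of (pi1 p0) t -> pi1 t = pi1 z -> col_lt t z) /\
      below n (finset_of d0) (pi2 p0) /\
      (forall t, finset_of d0 t -> pi1 t = pi1 z -> col_lt t z) /\
      supported W0 0 u (finset_of d0) /\ covers 1 (pi2 s) u); split.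
    + unfold supported, enum_op, below, col_lt, col_le, covers; enumerability.
    + intros y; split.
      * intros Cy; destruct (Case1 y Cy) as (p & [Fp Ep] &
          z & u & d0 & Gu & Ly & Hz & _ & L0 & Ld & S0 & S1).
        destruct (covers_exists 1 u B1) as (v & Hv & Bv).
        { intros x L Hx; apply EW1; exact (enum_op_mono _ _ _ Fp _ (S1 x L Hx)). }
        exists v; split; auto; exists z, u, d0; rewrite pi1_pair, pi2_pair.
        split; [destruct Ly, Cy; congruence |]; split; [now apply col_lt_le |].
        repeat (split; [assumption |]); assumption.
      * intros (v & (z & u & d0 & Ez & Ly & Gu & Hz & L0 & Ld & S0 & Hv) & Bv).
        rewrite pi1_pair, pi2_pair in *.
        destruct (supported_compact W1 1 u A) as (d1 & Ad1 & S1).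
        { intros x L Hx; apply EW1; auto. }
        (* The left support has nothing at or above [z] in its column, so the right support,
           contained in [A], reaches [z] and hence [y] is in [A]. *)
        destruct (Max z u d0 d1) as (t & [Ht | Ht] & Lt); auto.
        -- exact (below_sub _ _ _ _ Ad1 E0).
        -- exfalso; apply (col_lt_irrefl z), (col_le_lt_trans _ t); auto.
           apply Ld; auto; symmetry; apply Lt.
        -- split; [| destruct Ly; congruence].
           apply (generic_downward n A y z GA Ly), (generic_downward n A z t GA Lt); auto.
  - left.
    assert (H : exists z0, column A i z0 /\ ~ exists p, approximates n A p /\ O z0 p).
    { apply NNPP; intros N; apply Case2; intros z0 Cz; apply NNPP; intros N'; eauto. }
    destruct H as (z0 & [Az0 Ez0] & N0).
    destruct (proj2 (proj2 GA) (O z0) (HO z0)) as [H | (p1 & [F1 E1] & A1)]; [contradiction |].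
    (* Both [z] and the right support [d1] must respect the promises of [p1], so that adding them to
       [p1] gives a valid condition. *)
    exists (fun s => exists z u d1, pi1 z = i /\ col_le (pi1 s) z /\ col_lt z0 z /\ G ⟨z, u⟩ /\
      (forall t, finset_of (pi1 p0) t -> pi1 t = pi1 z -> col_lt t z) /\
      below n (finset_of d1) (pi2 p1) /\ below n (finset_of (2 ^ z)) (pi2 p1) /\
      supported W1 1 u (finset_of d1) /\ covers 0 (pi2 s) u); split.
    + unfold supported, enum_op, below, col_lt, col_le, covers; enumerability.
    + intros y; split.
      * intros [Ay Ey].
        (* An axiom for [y] itself may not qualify, as [y] may lie below [z0] or the lower part of
           [p0]; one for a larger member of the cut is used. *)
        destruct (generic_above n A y (Nat.lor (pi1 p0) (2 ^ z0)) GA) as (z & Az & Ly & Hz); auto.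
        { intros t Ht; apply finset_union in Ht as [Ht | Ht]; auto.
          apply finset_single in Ht; now subst. }
        assert (Ez : pi1 z = pi1 y) by (symmetry; apply Ly).
        destruct (proj1 (EG z)) as (u & Gu & Hu); [split; congruence |].
        apply finset_join in Hu as [U0 U1].
        destruct (covers_exists 0 u B0 U0) as (v & Hv & Bv).
        destruct (supported_compact W1 1 u A) as (d1 & Ad1 & S1).
        { intros x L Hx; apply EW1; auto. }
        exists v; split; auto; exists z, u, d1; rewrite pi1_pair, pi2_pair.
        split; [congruence |]; split; [now apply col_lt_le |].
        split; [apply Hz; [apply finset_union; right; now apply finset_single | congruence] |].
        split; [auto |]; split.
        { intros t Ht Et; apply Hz; [apply finset_union; auto | congruence]. }
        split; [exact (below_sub _ _ _ _ Ad1 E1) |]; split; [| auto].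
        apply (below_sub _ A); auto; intros t Ht; apply finset_single in Ht; now subst.
      * intros (v & (z & u & d1 & Ez & Ly & Lz & Gu & Hz & L1 & Lz1 & S1 & Hv) & Bv).
        rewrite pi1_pair, pi2_pair in *.
        destruct (supported_compact W0 0 u A) as (d0 & Ad0 & S0).
        { intros x L Hx; apply EW0; auto. }
        enough (Az : A z)
          by (split; [exact (generic_downward n A y z GA Ly Az) | destruct Ly; congruence]).
        (* If [z] were outside the cut, the left support, being inside [A], would stay below [z] in
           its column. Then [p1] enlarged by [z] and [d1] would belong to the avoided set [O z0]. *)
        apply NNPP; intros Nz.
        apply (A1 ⟨Nat.lor (pi1 p1) (Nat.lor d1 (2 ^ z)), Nat.lor (pi2 p1) 0⟩).
        -- apply valid_pair; rewrite Nat.lor_0_r.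
           apply below_lor; [exact (below_sub _ _ _ _ F1 E1) | now apply below_lor].
        -- apply extends_pair.
        -- exists z, u, d0; rewrite pi1_pair.
           split; [auto |]; split; [auto |]; split; [auto |]; split.
           { rewrite !finset_union, finset_single; auto. }
           split; [exact (below_sub _ _ _ _ Ad0 E0) |]; split; [| split; auto].
           ++ intros t Ht Et; destruct (col_lt_or_le t z Et) as [C | C]; auto.
              destruct Nz; exact (generic_downward n A z t GA C (Ad0 t Ht)).
           ++ apply (supported_mono _ _ _ (finset_of d1)); auto.
              intros t Ht; rewrite !finset_union; auto.
Qed.

(** * A low generic tuple *)

Lemma decidable_valid (n : nat) : decidable (valid n).
Proof. unfold valid, below, col_lt; decidability. Qed.

Lemma decidable_extends : decidable (fun z => extends (pi1 z) (pi2 z)).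
Proof. unfold extends; decidability. Qed.

(* Step [t] tries to enter the open set of the conditions [q] such that
   [⟨pi2 t, q⟩] is in the c.e. set with index [pi1 t]; carrying the parameter
   [pi2 t] avoids any appeal to an s-m-n theorem. *)
Definition step_goal (n x q : nat) : Prop :=
  valid n q /\ extends q (pi2 x) /\ ce_nth (pi1 (pi1 x)) ⟨pi2 (pi1 x), q⟩.

Lemma ce_step_goal (n : nat) : ce (fun z => step_goal n (pi1 z) (pi2 z)).
Proof.
  pose proof (decidable_valid n); pose proof decidable_extends.
  unfold step_goal; apply ce_and;
    [apply ce_decidable, (decidable_comp (valid n) (fun z => pi2 z));
      [assumption | computability] |].
  apply ce_and; [apply ce_decidable; decidability | enumerability].
Qed.

(** A relation rather than a function, since a step depends on the undecidable existence of an
    extension. With [sel] single-valued it is the graph of a total function. *)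
Fixpoint path (n init : nat) (sel : nat -> nat -> Prop) (t p : nat) : Prop :=
  match t with
  | 0 => p = init
  | S t => exists q, path n init sel t q /\
      (sel ⟨t, q⟩ p \/ (p = q /\ ~ exists r, step_goal n ⟨t, q⟩ r))
  end.

(** A finite run of the construction is verified by c.e. facts together with the negation of one
    c.e. fact, so [le_e_zero_jump] applies to [A]. It also applies to [K A] and its complement,
    because a fixed family of steps decides membership in [K A]. *)
Lemma exists_low_generic (n : nat) :
  exists A, generic n A /\ Sigma02 A /\ low A.
Proof.
  destruct (ce_uniformization _ (ce_step_goal n)) as (sel & Csel & Ssel & Usel & Tsel).
  assert (HF : exists F, forall y, finset_of F y <-> pi1 y < n /\ pi2 y = 0).
  { clear; induction n as [|m (F & HF)].
    - exists 0; intros y; split; [intros H; now apply finset_empty in H | lia].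
    - exists (Nat.lor F (2 ^ ⟨m, 0⟩)); intros y.
      rewrite finset_union, finset_single, HF, pair_eq; lia. }
  destruct HF as (F & HF).
  pose (init := ⟨F, 0⟩).
  pose (path := path n init sel).
  assert (Pfun : forall t p q, path t p -> path t q -> p = q).
  { induction t as [|t IH]; cbn; intros p q.
    - intros -> ->; reflexivity.
    - intros (p' & Hp & Sp) (q' & Hq & Sq).
      assert (q' = p') as -> by exact (IH _ _ Hq Hp).
      destruct Sp as [Sp | [-> Np]], Sq as [Sq | [-> Nq]]; eauto.
      + destruct Nq; eauto.
      + destruct Np; eauto. }
  assert (Ptot : forall t, exists p, path t p).
  { induction t as [|t [p IH]]; [exists init; reflexivity |].
    destruct (classic (exists r, step_goal n ⟨t, p⟩ r)) as [(r & Hr) | N].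
    - destruct (Tsel _ _ Hr) as (q & Hq); exists q, p; auto.
    - exists p, p; auto. }
  assert (Pstep : forall t p q, path t p -> path (S t) q ->
    (step_goal n ⟨t, p⟩ q /\ extends q p) \/ (q = p /\ ~ exists r, step_goal n ⟨t, p⟩ r)).
  { intros t p q Hp (p' & Hp' & [S | S]); rewrite (Pfun _ _ _ Hp' Hp) in S; auto.
    left; apply Ssel in S; split; auto.
    destruct S as (_ & X & _); now rewrite pi2_pair in X. }
  assert (Vinit : valid n init).
  { unfold init; apply valid_pair; intros z Hz; apply HF in Hz as [L _]; split; auto.
    intros w Hw; now apply finset_empty in Hw. }
  assert (Pvalid : forall t p, path t p -> valid n p).
  { induction t as [|t IH]; intros p.
    - intros ->; exact Vinit.
    - intros (q & Hq & [S | [-> _]]); [apply Ssel in S; apply S | exact (IH _ Hq)]. }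
  assert (Pext : forall t s p q, path t p -> path (s + t) q -> extends q p).
  { intros t; induction s as [|s IH]; intros p q Hp Hq.
    - rewrite (Pfun _ _ _ Hq Hp); apply extends_refl.
    - destruct (Ptot (s + t)) as (r & Hr).
      destruct (Pstep _ _ _ Hr Hq) as [[_ X] | [-> _]]; [| eauto].
      exact (extends_trans _ _ _ X (IH _ _ Hp Hr)). }
  pose (A := fun z => exists t p, path t p /\ finset_of (pi1 p) z).
  assert (Papx : forall t p, path t p -> approximates n A p).
  { intros t p Hp; split; [intros z Hz; exists t, p; auto |].
    intros z (s & q & Hq & Hz).
    (* The stage where [z] enters and the stage of the promise are compared at a common later stage,
       whose condition is valid. *)
    destruct (Ptot (s + t)) as (r & Hr).
    destruct (Pext t s p r Hp Hr) as [_ X].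
    rewrite Nat.add_comm in Hr; destruct (Pext s t q r Hq Hr) as [Y _].
    destruct (Pvalid _ _ Hr z (Y z Hz)) as [L E]; split; auto. }
  assert (Pmeet : forall e k, let t := ⟨e, k⟩ in forall p, path t p ->
    (exists r, step_goal n ⟨t, p⟩ r) ->
    exists q, approximates n A q /\ ce_nth e ⟨k, q⟩).
  { intros e k t p Hp Hr; destruct (Ptot (S t)) as (q & Hq); exists q; split; [eauto |].
    destruct (Pstep _ _ _ Hp Hq) as [[(_ & _ & H) _] | [_ N]]; [| contradiction].
    unfold t in H; now repeat rewrite ?pi1_pair, ?pi2_pair in H. }
  assert (Pavoid : forall e k, let t := ⟨e, k⟩ in forall p, path t p ->
    ~ (exists r, step_goal n ⟨t, p⟩ r) -> avoids n p (fun q => ce_nth e ⟨k, q⟩)).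
  { intros e k t p Hp N q Vq Xq Hq; apply N; exists q; unfold step_goal, t.
    now repeat rewrite ?pi1_pair, ?pi2_pair. }
  assert (GA : generic n A).
  { split; [| split].
    - intros z (t & p & Hp & Hz); now apply (Pvalid t p Hp).
    - intros i L; exists 0, init; split; [reflexivity |].
      unfold init; rewrite pi1_pair; apply HF; now rewrite pi1_pair, pi2_pair.
    - intros O HO.
      (* Steps carry a parameter; [O] has none, so a dummy one is added and set to 0. *)
      assert (HO' : ce (fun z => O (pi2 z))) by enumerability.
      destruct HO' as (e & He).
      assert (E : forall q, ce_nth e ⟨0, q⟩ <-> O q)
        by (intros q; rewrite <- He, pi2_pair; reflexivity).
      destruct (Ptot ⟨e, 0⟩) as (p & Hp).
      destruct (classic (exists r, step_goal n ⟨⟨e, 0⟩, p⟩ r)) as [H | H].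
      + left; destruct (Pmeet e 0 p Hp H) as (q & Hq & Oq); exists q; split; auto; now apply E.
      + right; exists p; split; [eauto |]; intros q Vq Xq Oq.
        apply (Pavoid e 0 p Hp H q Vq Xq), E, Oq. }
  (* A finite set [u] of pairs (t, p) describing the construction, where [v] collects
     the steps at which no extension is claimed to exist. *)
  pose (just := fun u v => forall y, finset_of u y ->
    (pi1 y = 0 /\ pi2 y = init) \/
    exists t p, pi1 y = S t /\ finset_of u ⟨t, p⟩ /\
      (sel ⟨t, p⟩ (pi2 y) \/ (pi2 y = p /\ finset_of v ⟨t, p⟩))).
  (* Some claim recorded in [v] is false. This is c.e., so the correctness of all claims in [v] is a
     single negated c.e. fact. *)
  pose (bad := fun v => exists y, finset_of v y /\ exists r, step_goal n y r).
  assert (Jsound : forall u v, just u v -> ~ bad v ->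
    forall t p, finset_of u ⟨t, p⟩ -> path t p).
  { intros u v J B; induction t as [|t IH]; intros p Hp;
      destruct (J _ Hp) as [[E1 E2] | (s & q & E1 & Hq & S)];
      rewrite ?pi1_pair, ?pi2_pair in *; try discriminate; auto.
    injection E1 as <-; exists q; split; [exact (IH _ Hq) |].
    destruct S as [S | [-> S]]; auto.
    right; split; auto; intros H; apply B; exists ⟨t, q⟩; auto. }
  assert (Jcomplete : forall t p, path t p ->
    exists u v, finset_of u ⟨t, p⟩ /\ just u v /\ ~ bad v).
  { induction t as [|t IH]; intros p.
    - intros ->; exists (2 ^ ⟨0, init⟩), 0; repeat split.
      + now apply finset_single.
      + intros y Hy; apply finset_single in Hy; subst y; rewrite pi1_pair, pi2_pair; auto.
      + intros (y & Hy & _); now apply finset_empty in Hy.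
    - intros (q & Hq & Hs); destruct (IH q Hq) as (u & v & Hu & J & B).
      assert (M : forall v', (forall y, finset_of v y -> finset_of v' y) ->
        (sel ⟨t, q⟩ p \/ (p = q /\ finset_of v' ⟨t, q⟩)) ->
        just (Nat.lor u (2 ^ ⟨S t, p⟩)) v').
      { intros v' Hv' S' y Hy; apply finset_union in Hy as [Hy | Hy].
        - destruct (J y Hy) as [? | (s & r & E & Hr & C)]; auto; right.
          exists s, r; repeat split; auto; [apply finset_union; auto |].
          destruct C as [C | [C1 C2]]; auto.
        - apply finset_single in Hy; subst y; rewrite pi1_pair, pi2_pair; right.
          exists t, q; repeat split; auto; apply finset_union; auto. }
      assert (I : finset_of (Nat.lor u (2 ^ ⟨S t, p⟩)) ⟨S t, p⟩)
        by (apply finset_union; right; now apply finset_single).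
      destruct Hs as [Hs | [-> N]].
      + exists (Nat.lor u (2 ^ ⟨S t, p⟩)), v; auto.
      + exists (Nat.lor u (2 ^ ⟨S t, q⟩)), (Nat.lor v (2 ^ ⟨t, q⟩)); split; [auto | split].
        * apply M; [intros; apply finset_union; auto |]; right; split; auto.
          apply finset_union; right; now apply finset_single.
        * intros (y & Hy & Hr); apply finset_union in Hy as [Hy | Hy]; [apply B; exists y; auto |].
          apply finset_single in Hy; subst y; auto. }
  pose proof (ce_step_goal n) as Cgoal.
  assert (Cjust : ce (fun z => just (pi1 z) (pi2 z))) by (unfold just; enumerability).
  assert (Cbad : ce bad) by (unfold bad; enumerability).
  (* With this index [e], step [⟨e, z⟩] tries to put into the tuple the finite set of some axiom
     that enters [z] into [K A]. *)
  assert (Ku : ce (fun z => exists v, ce_nth (pi1 (pi1 z)) ⟨pi2 (pi1 z), v⟩ /\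
    forall y, finset_of v y -> finset_of (pi1 (pi2 z)) y)) by enumerability.
  destruct Ku as (e & He).
  assert (Kspec : forall z p, path ⟨e, z⟩ p ->
    (K A z <-> exists r, step_goal n ⟨⟨e, z⟩, p⟩ r)).
  { intros z p Hp; split.
    - intros (d & x & -> & v & Hv & Av); apply NNPP; intros N.
      (* If no extension existed, a refinement of [p] containing the finite subset [v] of [A] would
         contradict avoidance. *)
      destruct (avoids_refine n A _ p ⟨v, 0⟩ (Papx _ _ Hp) (Pavoid e _ p Hp N))
        as (r & Hr & _ & [Xr _] & Ar); [now apply approximates_finset |].
      apply (Ar r (approximates_valid _ _ _ Hr) (extends_refl r)).
      rewrite <- He; repeat rewrite ?pi1_pair, ?pi2_pair; exists v; split; auto.
      rewrite pi1_pair in Xr; auto.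
    - intros H; destruct (Pmeet e z p Hp H) as (q & [Fq _] & Hq).
      rewrite <- He in Hq; destruct Hq as (v & Hv & Sv).
      rewrite !pi1_pair in Hv; rewrite pi2_pair in Sv.
      exists (pi1 z), (pi2 z); split; [now rewrite pair_pi |]; exists v; auto. }
  exists A; split; [exact GA | split].
  - unfold Sigma02.
    (* The witness packs the record [⟨u, v⟩] of a run with a stage and its condition. *)
    apply (le_e_zero_jump A
      (fun z w => just (pi1 (pi1 w)) (pi2 (pi1 w)) /\ finset_of (pi1 (pi1 w)) (pi2 w) /\
         finset_of (pi1 (pi2 (pi2 w))) z)
      (fun _ w => bad (pi2 (pi1 w)))); [enumerability | enumerability |].
    intros z; split.
    + intros (t & p & Hp & Hz); destruct (Jcomplete t p Hp) as (u & v & Hu & J & B).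
      exists ⟨⟨u, v⟩, ⟨t, p⟩⟩; now repeat rewrite ?pi1_pair, ?pi2_pair.
    + intros (w & (J & Hw & Hz) & B); exists (pi1 (pi2 w)), (pi2 (pi2 w)); split; auto.
      apply (Jsound _ _ J B); now rewrite pair_pi.
  - apply le_e_join.
    + apply (le_e_zero_jump _
        (fun z w => just (pi1 (pi1 w)) (pi2 (pi1 w)) /\
           finset_of (pi1 (pi1 w)) ⟨⟨e, z⟩, pi2 w⟩ /\ exists r, step_goal n ⟨⟨e, z⟩, pi2 w⟩ r)
        (fun _ w => bad (pi2 (pi1 w)))); [enumerability | enumerability |].
      intros z; split.
      * intros Kz; destruct (Ptot ⟨e, z⟩) as (p & Hp).
        destruct (Jcomplete _ p Hp) as (u & v & Hu & J & B).
        exists ⟨⟨u, v⟩, p⟩; repeat rewrite ?pi1_pair, ?pi2_pair.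
        pose proof (proj1 (Kspec z p Hp) Kz); auto.
      * intros (w & (J & Hw & Hr) & B).
        exact (proj2 (Kspec z _ (Jsound _ _ J B _ _ Hw)) Hr).
    (* The negative part is now a disjunction: neither a false claim in the record nor an extension
       at step [⟨e, z⟩] may exist. *)
    + apply (le_e_zero_jump _
        (fun z w => just (pi1 (pi1 w)) (pi2 (pi1 w)) /\
           finset_of (pi1 (pi1 w)) ⟨⟨e, z⟩, pi2 w⟩)
        (fun z w => bad (pi2 (pi1 w)) \/ exists r, step_goal n ⟨⟨e, z⟩, pi2 w⟩ r));
        [enumerability | enumerability |].
      intros z; split.
      * intros Kz; destruct (Ptot ⟨e, z⟩) as (p & Hp).
        destruct (Jcomplete _ p Hp) as (u & v & Hu & J & B).
        exists ⟨⟨u, v⟩, p⟩; repeat rewrite ?pi1_pair, ?pi2_pair; split; [auto |].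
        intros [Hb | Hr]; [auto | apply Kz, (Kspec z p Hp), Hr].
      * intros (w & (J & Hw) & B) Kz; apply B; right.
        assert (NB : ~ bad (pi2 (pi1 w))) by auto.
        exact (proj1 (Kspec z _ (Jsound _ _ J NB _ _ Hw)) Kz).
Qed.

(** * Counting columns *)

(** Finitely many reductions merge by union. Used contrapositively: a set strictly below [A] fails
    to compute some column. *)
Lemma le_e_columns (n : nat) (A B : natset) :
  (forall z, A z -> pi1 z < n) -> (forall i, i < n -> le_e (column A i) B) -> le_e A B.
Proof.
  intros HA H.
  assert (G : forall m, m <= n -> exists X, le_e X B /\ forall z, X z <-> A z /\ pi1 z < m).
  { induction m as [|m IH]; intros L.
    - exists (fun _ => False); split; [| intros z; lia].
      exists (fun _ => 0 = 1); split; [enumerability |].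
      intros x; unfold enum_op; split; [tauto | intros (u & F & _); discriminate F].
    - destruct IH as (X & HX & EX); [lia |].
      exists (fun z => X z \/ column A m z); split; [apply le_e_union; auto |].
      intros z; unfold column; rewrite EX, Nat.lt_succ_r, Nat.le_lteq; tauto. }
  destruct (G n (le_n n)) as (X & (W & HW & EW) & EX).
  exists W; split; auto; intros z; rewrite <- EW, EX; split; [auto | tauto].
Qed.

(** Each element is off at least one of two distinct columns, so it survives in one half of the
    join, where a singleton axiom finds it. *)
Lemma le_e_join_off_columns (A : natset) (i j : nat) :
  i <> j -> le_e A (join (off_column A i) (off_column A j)).
Proof.
  intros N.
  exists (fun s => pi2 s = 2 ^ (2 * pi1 s) \/ pi2 s = 2 ^ (2 * pi1 s + 1)); split;
    [enumerability |].
  intros z; unfold enum_op; setoid_rewrite pi1_pair; setoid_rewrite pi2_pair; split.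
  - intros Az; destruct (Nat.eq_dec (pi1 z) i) as [E | E].
    + exists (2 ^ (2 * z + 1)); split; auto; intros y Hy; apply finset_single in Hy; subst y.
      right; exists z; repeat split; auto; congruence.
    + exists (2 ^ (2 * z)); split; auto; intros y Hy; apply finset_single in Hy; subst y.
      left; exists z; repeat split; auto.
  - intros (u & [-> | ->] & H); specialize (H _ (proj2 (finset_single _ _) eq_refl));
      destruct H as [(x & [Ax _] & E) | (x & [Ax _] & E)];
      (replace z with x by lia; exact Ax) || lia.
Qed.

(** Stated for a relation, so that no function choosing a missed column for each set is required. *)
Lemma pigeonhole (R : nat -> nat -> Prop) (n : nat) :
  (forall k, k <= n -> exists i, i < n /\ R k i) ->
  exists k l i, k <= n /\ l <= n /\ k <> l /\ R k i /\ R l i.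
Proof.
  revert R; induction n as [|n IH]; intros R H.
  - destruct (H 0 (le_n 0)) as (i & L & _); lia.
  - destruct (H (S n) (le_n _)) as (i & Li & Ri).
    destruct (classic (exists k, k <= n /\ R k i)) as [(k & Lk & Rk) | N].
    { exists k, (S n), i; repeat split; auto; lia. }
    (* The pigeonholes left are those other than [i]: rename [n] to [i]. *)
    destruct (IH (fun k j => R k (if Nat.eq_dec j i then n else j)))
      as (k & l & j & Lk & Ll & D & Rk & Rl).
    + intros k Lk; destruct (H k) as (j & Lj & Rj); [lia |].
      assert (j <> i) by (intros ->; apply N; eauto).
      destruct (Nat.eq_dec j n) as [-> | Nj].
      * exists i; split; [lia |]; destruct (Nat.eq_dec i i); [auto | congruence].
      * exists j; split; [lia |]; destruct (Nat.eq_dec j i); [contradiction | auto].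
    + exists k, l; eexists; repeat split; try exact Rk; try exact Rl; lia.
Qed.

Theorem theorem6p1 (n : nat) (hn : 1 <= n) :
  exists A : natset,
    Sigma02 A /\ low A /\ join_irreducible n A /\ join_reducible (n - 1) A.
Proof.
  destruct (exists_low_generic n) as (A & GA & SA & LA).
  exists A; split; [exact SA | split; [exact LA | split]].
  - intros B HB.
    destruct (pigeonhole (fun k i => ~ le_e (column A i) (B k)) n)
      as (k & l & i & Lk & Ll & D & Nk & Nl).
    { intros k Lk; apply NNPP; intros N; apply (HB k Lk), (le_e_columns n); [apply GA |].
      intros i Li; apply NNPP; intros Ni; eauto. }
    exists k, l; repeat split; auto.
    + apply le_e_join; now apply HB.
    + intros H; assert (C : le_e (column A i) (join (B k) (B l)))
        by (apply le_e_restrict; [decidability | exact H]).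
      apply (column_join_prime n A i) in C as [C | C]; auto; now apply HB.
  - destruct (Nat.eq_dec n 1) as [-> | N]; [now left | right].
    (* Indices up to [n - 1] give exactly one set for each of the [n] columns; the join of the two
       sets produced would lie strictly below [A]. *)
    intros H; destruct (H (off_column A)) as (i & j & Li & Lj & D & _ & C).
    + intros i Li; split; [apply le_e_restrict; [decidability | apply le_e_refl] |].
      apply (off_column_not_ge n); auto; lia.
    + now apply C, le_e_join_off_columns.
Qed.
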